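(* Let $\nu$ be an Abhyankar valuation on $k[[x]]$, $k$ a field of characteristic zero. Let $P(Z)\in V_\nu^{\mathrm{fg}}[Z]$ be a monic polynomial of degree $d$ with no multiple factor, and write $P(Z)=P_1(Z)\cdots P_r(Z)$ where the $P_i(Z)\in V_\nu^{\mathrm{fg}}[Z]$, $1\le i\le r$, are irreducible monic polynomials. Let $z_1,\dots,z_d$ be the roots of $P(Z)$ and let $Q(Z)\in V_\nu^{\mathrm{fg}}[Z]$ be a monic polynomial. If $\deg Q(Z)=\deg P(Z)$ and $$\nu(Q(Z)-P(Z))>d\,\max_{i\ne j}\{\nu(z_i-z_j)\},$$ then one may factor $Q(Z)=Q_1(Z)\cdots Q_r(Z)$ where each $Q_i(Z)\in V_\nu^{\mathrm{fg}}[Z]$ is an irreducible monic polynomial, $1\le i\le r$, and $$\nu(Q_i(Z)-P_i(Z))\ge\frac{\nu(Q(Z)-P(Z))}{d}.$$ The result is still valid if $V_\nu^{\mathrm{fg}}$ is replaced everywhere by $V_\nu^{\mathrm{alg}}$ or by $\widehat V_\nu$.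
   Context: Valuations. $x=(x_1,\dots,x_n)$, $n\ge2$, $K_n=\mathrm{Frac}(k[[x]])$. A valuation $\nu$ on $k[[x]]$ takes values in $\Gamma\cap\mathbb{R}_{\ge0}=:\Gamma^+$ on nonzero series, $\Gamma$ a subgroup of $\mathbb{R}$, with the usual axioms, $\nu(0)=\infty$, and $\nu(f)>0$ iff $f$ is in the maximal ideal; it extends to $K_n$ and $\nu:K_n^*\to\Gamma$ is assumed surjective. $V_\nu$ is its valuation ring, $k_\nu$ its residue field. $\nu$ is an Abhyankar valuation if $\mathrm{tr.deg}_k k_\nu+\dim_{\mathbb{Q}}\Gamma\otimes\mathbb{Q}=n$. $\widehat V_\nu$ is the completion of $V_\nu$ for the topology given by the ideals $\{\nu\ge\lambda\}$, and $\widehat K_\nu=\mathrm{Frac}(\widehat V_\nu)$. The valuation extends uniquely to an algebraic closure of $\widehat K_\nu$, in which the roots of polynomials are taken. For a polynomial $P(Z)$, $\nu(P(Z))$ is the minimum of the valuations of its coefficients. $V_\nu^{\mathrm{alg}}$ is the ring of elements of $\widehat V_\nu$ algebraic over $K_n$. Supports. There are (and one fixes) a regular local domain $(A,\mathfrak m_A)$, an injective morphism $k[x]\to A$ inducing an isomorphism of fraction fields, and a regular system of parameters $z_1,\dots,z_r$ of $A$ such that $\nu(z_1),\dots,\nu(z_r)$ freely generate $\Gamma$, $\widehat V_\nu$ is identified with the completed valuation ring of $\nu|_A$, $\widehat A\simeq L[[z_1,\dots,z_r]]$ with $L=A/\mathfrak m_A$ of transcendence degree $n-r$ over $k$, and $\nu$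 extends to $\widehat A$ as the monomial valuation giving $z_j$ the weight $\nu(z_j)$ (these $z_j$ and $r$ are unrelated to the roots and number of factors in the claim). Then elements of $\widehat V_\nu$ are uniquely $\sum_{i\in\Lambda}w_i$, with $\Lambda\subset\Gamma^+$ finite or countable without accumulation point and $w_i\in L\cdot z^{\beta(i)}$, where $\beta(i)\in\mathbb{Z}^r$ is defined by $\sum_j\beta(i)_j\nu(z_j)=i$. (When $\nu=\nu_\alpha$ is the monomial valuation $\nu_\alpha(x_j)=\alpha_j>0$ on $k[[x]]$, one uses instead the unique expansion $\sum_i w_i$ with $w_i$ equal to $0$ or to a fraction $a/b$ of nonzero polynomials of $k[x]$ weighted homogeneous for the weights $\alpha_j$, with $\nu_\alpha(a)-\nu_\alpha(b)=i$.) The $\nu$-support of $\sum_i w_i$ is $\{i:w_i\ne0\}$, and $V_\nu^{\mathrm{fg}}$ is the set (a valuation ring) of elements of $\widehat V_\nu$ whose $\nu$-support is contained in a finitely generated sub-semigroup of $\mathbb{R}_{\ge0}$. *)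

(* Defs.v *)
From HB Require Import structures.
From mathcomp Require Import all_boot all_order all_algebra.
From mathcomp Require Import boolp classical_sets fsbigop topology.
From mathcomp Require Import reals constructive_ereal ereal normedtype.
(* The grammar of the notations of mpoly conflicts with that of ereal. *)
From mathcomp.multinomials Require Import -(notations) mpoly.

Set Implicit Arguments.
Unset Strict Implicit.
Unset Printing Implicit Defensive.

Import Order.TTheory GRing.Theory Num.Theory numFieldNormedType.Exports.

Local Open Scope classical_set_scope.
Local Open Scope ring_scope.

Record mfps (n : nat) (k : fieldType) := MFPS { fcoef : multinom n -> k }.

HB.instance Definition _ n k := gen_eqMixin (mfps n k).
HB.instance Definition _ n k := gen_choiceMixin (mfps n k).

Section PowerSeries.
Context {n : nat} {k : fieldType}.
Implicit Types (f g h : mfps n k) (m : multinom n) (p q : mpoly n k) (c : k).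

Lemma mfpsP f g : fcoef f =1 fcoef g -> f = g.
Proof. by case: f g => [f] [g] /= /funext ->. Qed.

Definition fzero := @MFPS n k (fun=> 0).
Definition fopp f := MFPS (fun m => - fcoef f m).
Definition fadd f g := MFPS (fun m => fcoef f m + fcoef g m).

Fact faddA : associative fadd.
Proof. by move=> f g h; apply: mfpsP => m /=; rewrite addrA. Qed.
Fact faddC : commutative fadd.
Proof. by move=> f g; apply: mfpsP => m /=; rewrite addrC. Qed.
Fact fadd0 : left_id fzero fadd.
Proof. by move=> f; apply: mfpsP => m /=; rewrite add0r. Qed.
Fact faddN : left_inverse fzero fopp fadd.
Proof. by move=> f; apply: mfpsP => m /=; rewrite addNr. Qed.

HB.instance Definition _ := GRing.isZmodule.Build (mfps n k)
  faddA faddC fadd0 faddN.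

Definition mfps_of_mpoly p := MFPS (fun m => mcoeff m p).
Definition fone := mfps_of_mpoly 1.

(* Cauchy product: the pairs (a, b) of exponents with a + b = m. *)
Definition fmul f g := MFPS (fun m =>
  \sum_(ab : bmultinom n (mdeg m).+1 * bmultinom n (mdeg m).+1
          | m == mnm_add ab.1 ab.2) fcoef f ab.1 * fcoef g ab.2).

Definition ftrunc D f : mpoly n k :=
  \sum_(m : bmultinom n D) fcoef f m *: mpolyX k m.

Fact ftruncE D f m : (mdeg m < D)%N -> mcoeff m (ftrunc D f) = fcoef f m.
Proof. exact: mcoeff_mpoly. Qed.

Fact mcoeffM_trunc p p' q q' m :
    (forall a, (mdeg a <= mdeg m)%N -> mcoeff a p = mcoeff a p') ->
    (forall a, (mdeg a <= mdeg m)%N -> mcoeff a q = mcoeff a q') ->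
  mcoeff m (p * q) = mcoeff m (p' * q').
Proof.
move=> ep eq; rewrite !mcoeffM; apply: eq_bigr => -[a b] /= _.
by rewrite ep ?eq // -ltnS bmdeg.
Qed.

Fact fmulE D f g m : (mdeg m < D)%N ->
  fcoef (fmul f g) m = mcoeff m (ftrunc D f * ftrunc D g).
Proof.
move=> mD; rewrite mcoeffM /=; apply: eq_bigr => -[a b] /= _.
by rewrite !ftruncE //; apply: leq_trans mD; apply: bmdeg.
Qed.

Fact fmulA : associative fmul.
Proof.
move=> f g h; apply: mfpsP => m; pose D := (mdeg m).+1.
have lt a : (mdeg a <= mdeg m)%N -> (mdeg a < D)%N by [].
rewrite !(@fmulE D) //.
transitivity (mcoeff m (ftrunc D f * (ftrunc D g * ftrunc D h))).
  by apply: mcoeffM_trunc => // a /lt aD; rewrite ftruncE // (@fmulE D).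
rewrite mulrA; apply: mcoeffM_trunc => // a /lt aD.
by rewrite ftruncE // (@fmulE D).
Qed.

Fact fmulC : commutative fmul.
Proof.
by move=> f g; apply: mfpsP => m; rewrite !(@fmulE (mdeg m).+1) // mulrC.
Qed.

Fact fmul1 : left_id fone fmul.
Proof.
move=> f; apply: mfpsP => m; pose D := (mdeg m).+1.
rewrite (@fmulE D) // -[RHS](@ftruncE D) // -[in RHS](mul1r (ftrunc D f)).
by apply: mcoeffM_trunc => // a am; rewrite ftruncE.
Qed.

Fact fmulDl : left_distributive fmul fadd.
Proof.
move=> f g h; apply: mfpsP => m; pose D := (mdeg m).+1.
rewrite /= -big_split /=; apply: eq_bigr => ab _; exact: mulrDl.
Qed.

Fact fone_neq0 : fone != 0 :> mfps n k.
Proof.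
apply/eqP => /(congr1 (fun f => fcoef f (@mnm0 n))) /=.
by rewrite mcoeff1 eqxx => /eqP; rewrite oner_eq0.
Qed.

HB.instance Definition _ := GRing.Zmodule_isComNzRing.Build (mfps n k)
  fmulA fmulC fmul1 fmulDl fone_neq0.

Definition funit : {pred mfps n k} := fun f => `[< exists g, g * f = 1 >].
Definition fminv f := if pselect (exists g, g * f = 1) is left e
  then projT1 (cid e) else f.

Fact fmulVf : {in funit, left_inverse 1 fminv *%R}.
Proof. by rewrite /fminv => f /asboolP e; case: pselect => // e'; case: cid. Qed.
Fact funitP f g : g * f = 1 -> f \in funit.
Proof. by move=> e; apply/asboolP; exists g. Qed.
Fact fminv_out : {in [predC funit], fminv =1 id}.
Proof. by rewrite /fminv => f /asboolP e; case: pselect. Qed.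

HB.instance Definition _ := GRing.ComNzRing_hasMulInverse.Build (mfps n k)
  fmulVf funitP fminv_out.

Fact fcoef_min f : f != 0 -> exists2 m, fcoef f m != 0 &
  forall a, fcoef f a != 0 -> (m <= a)%O.
Proof.
move=> f0; have [m fm] : exists m, fcoef f m != 0.
  apply: contrapT => /forallNP f0'; case/eqP: f0; apply: mfpsP => m.
  by apply/eqP; apply/negPn/negP; apply: f0'.
elim/(well_founded_ind (@ltom_wf n)): m fm => m IH fm.
have [[a [am fa]]|min] := pselect (exists a, (a < m)%O /\ fcoef f a != 0).
  exact: IH fa.
exists m => // a fa; rewrite leNgt; apply/negP => am; apply: min.
by exists a.
Qed.

Fact fmul_eq0 f g : f * g = 0 -> (f == 0) || (g == 0).
Proof.
move=> fg0; apply/norP => -[/fcoef_min[a fa amin] /fcoef_min[b gb bmin]].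
move: (congr1 (fun f => fcoef f (mnm_add a b)) fg0) => /=.
have aD : (mdeg a < (mdeg (mnm_add a b)).+1)%N by rewrite mdegD ltnS leq_addr.
have bD : (mdeg b < (mdeg (mnm_add a b)).+1)%N by rewrite mdegD ltnS leq_addl.
rewrite (bigD1 (BMultinom aD, BMultinom bD)) //= big1 ?addr0.
  by move=> /eqP; rewrite mulf_eq0 (negbTE fa) (negbTE gb).
move=> -[[u uD] [v vD]] /= /andP[/eqP euav neq].
apply/eqP; rewrite mulf_eq0 -implyNb.
apply/implyP => /amin au; apply/negPn/negP => /bmin bv.
case/negP: neq; rewrite xpair_eqE -!val_eqE /=.
move: au; rewrite le_eqVlt => /orP[/eqP ea|lau]; last first.
  by have := ltmc_le_add lau bv; rewrite -euav ltxx.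
by move: euav; rewrite ea => /addmI <-; rewrite !eqxx.
Qed.

HB.instance Definition _ :=
  GRing.ComUnitRing_isIntegral.Build (mfps n k) fmul_eq0.

Fact mfps_of_mpoly_zmod : zmod_morphism mfps_of_mpoly.
Proof. by move=> p q; apply: mfpsP => m; rewrite /= mcoeffB. Qed.
Fact mfps_of_mpoly_monoid : monoid_morphism mfps_of_mpoly.
Proof. by split=> // p q; apply: mfpsP => m; rewrite /= mcoeffM. Qed.
HB.instance Definition _ :=
  GRing.isZmodMorphism.Build _ _ mfps_of_mpoly mfps_of_mpoly_zmod.
HB.instance Definition _ :=
  GRing.isMonoidMorphism.Build _ _ mfps_of_mpoly mfps_of_mpoly_monoid.

Definition fconst c := mfps_of_mpoly (mpolyC n c).
Definition fX (j : 'I_n) := mfps_of_mpoly (mpolyX k (mnm1 j)).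

Definition fcoef0 f := fcoef f (@mnm0 n).

Fact fcoef0_zmod : zmod_morphism fcoef0.
Proof. by []. Qed.
Fact fcoef0_monoid : monoid_morphism fcoef0.
Proof.
split=> [|f g]; first by rewrite /fcoef0 /= mcoeff1 eqxx.
rewrite /fcoef0 [LHS](@fmulE 1) ?mdeg0 // (mcoeff0_is_multiplicative _ _).1.
by rewrite !ftruncE ?mdeg0.
Qed.
HB.instance Definition _ := GRing.isZmodMorphism.Build _ _ fcoef0 fcoef0_zmod.
HB.instance Definition _ :=
  GRing.isMonoidMorphism.Build _ _ fcoef0 fcoef0_monoid.

End PowerSeries.

Section Ideals.
Context {A : comNzRingType}.
Implicit Types (I J : set A).

Definition ideal I :=
  [/\ I 0, forall x y, I x -> I y -> I (x + y) & forall a x, I x -> I (a * x)].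

Definition prime_ideal I :=
  [/\ ideal I, ~ I 1 & forall x y, I (x * y) -> I x \/ I y].

Definition ideal_gen s (g : 'I_s -> A) : set A :=
  [set x | exists c : 'I_s -> A, x = \sum_i c i * g i].

Definition ideal_pow I (N : nat) : set A :=
  [set x | exists s (c : 'I_s -> A) (t : 'I_s -> 'I_N -> A),
     (forall i j, I (t i j)) /\ x = \sum_i c i * \prod_j t i j].

End Ideals.

Definition noetherian (A : comNzRingType) :=
  forall I : set A, ideal I -> exists s (g : 'I_s -> A), I = ideal_gen g.

Definition local_ring (A : comUnitRingType) (m : set A) :=
  ideal m /\ forall x, m x <-> x \isn't a GRing.unit.

Definition prime_chain (A : comNzRingType) (d : nat) (p : nat -> set A) :=
  (forall i, (i <= d)%N -> prime_ideal (p i)) /\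
  (forall i, (i < d)%N -> p i `<` p i.+1).

Definition krull_dim (A : comNzRingType) (d : nat) :=
  (exists p : nat -> set A, prime_chain d p) /\
  (forall e (p : nat -> set A), prime_chain e p -> (e <= d)%N).

(* A is a regular local ring with maximal ideal m, and z is a regular system
   of parameters. *)
Definition regular_system (A : comUnitRingType) (m : set A)
    (r : nat) (z : 'I_r -> A) :=
  [/\ noetherian A, local_ring m, krull_dim A r & m = ideal_gen z].

(* psi exhibits B, with the J-adic topology, as the I-adic completion of A:
   B is separated and complete, and A/I^N -> B/J^N is bijective for all N. *)
Record adic_completion (A B : comNzRingType) (I : set A) (J : set B)
    (psi : {rmorphism A -> B}) : Prop := AdicCompletion {
  adic_separated : forall b, (forall N, ideal_pow J N b) -> b = 0;
  adic_complete : forall u : nat -> B,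
    (forall N, ideal_pow J N (u N.+1 - u N)) ->
    exists l, forall N, ideal_pow J N (l - u N);
  adic_inj : forall N a, ideal_pow I N a <-> ideal_pow J N (psi a);
  adic_surj : forall N b, exists a, ideal_pow J N (b - psi a) }.

Definition alg_indep (k F : fieldType) (f : k -> F) t (u : 'I_t -> F) :=
  forall p : mpoly t k, mmap f u p = 0 -> p = 0.

Definition trdeg (k F : fieldType) (f : k -> F) (t : nat) :=
  (exists u : 'I_t -> F, alg_indep f u) /\
  (forall s (u : 'I_s -> F), alg_indep f u -> (s <= t)%N).

(* Any Q-linearly independent family of G (x) Q becomes, after clearing
   denominators, a Z-linearly independent family of G. *)
Definition rational_rank (R : realType) (G : set R) (t : nat) :=
  let indep s (u : 'I_s -> R) := (forall i, G (u i)) /\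
    (forall c : 'I_s -> int, \sum_i u i *~ c i = 0 -> forall i, c i = 0) in
  (exists u : 'I_t -> R, indep t u) /\
  (forall s (u : 'I_s -> R), indep s u -> (s <= t)%N).

Section Valuations.
Context {R : realType} {K : fieldType}.
Implicit Types (v : K -> \bar R) (V m : set K).

Definition valuation v :=
  [/\ v 0 = +oo%E, forall x, x != 0 -> v x \is a fin_num,
      forall x y, v (x * y) = (v x + v y)%E &
      forall x y, (Order.min (v x) (v y) <= v (x + y)%R)%E].

Definition val_ring v : set K := [set x | (0 <= v x)%E].
Definition val_ideal v : set K := [set x | (0 < v x)%E].
Definition value_group v : set R :=
  [set g | exists2 x, x != 0 & v x = g%:E].

(* res, restricted to the subring V of K, identifies kappa with V/m; its values
   outside V are irrelevant. *)
Definition residue_map V m (kappa : fieldType) (res : K -> kappa) :=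
  [/\ res 1 = 1,
      forall x y, V x -> V y -> res (x + y) = res x + res y,
      forall x y, V x -> V y -> res (x * y) = res x * res y,
      forall c, exists2 x, V x & res x = c &
      forall x, V x -> (res x = 0 <-> m x)].

Definition poly_val v (p : {poly K}) : \bar R :=
  \big[Order.min/+oo%E]_(i < size p) v p`_i.

End Valuations.

Definition extends_val (R : realType) (K F : fieldType) (f : K -> F)
  (v : K -> \bar R) (w : F -> \bar R) := forall x, w (f x) = v x.

(* nu is the extension to Frac k[[x]] of a valuation on k[[x]] which is
   positive exactly on the maximal ideal. *)
Definition series_valuation (R : realType) n (k : fieldType)
    (nu : {fraction mfps n k} -> \bar R) :=
  [/\ valuation nu, forall f : mfps n k, (0 <= nu (tofrac f))%E &
      forall f : mfps n k, (0 < nu (tofrac f))%E <-> fcoef0 f = 0].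

Definition Abhyankar (R : realType) n (k : fieldType)
    (nu : {fraction mfps n k} -> \bar R) :=
  exists (kappa : fieldType) (res : {fraction mfps n k} -> kappa) (t s : nat),
    [/\ residue_map (val_ring nu) (val_ideal nu) res,
        trdeg (fun c : k => res (tofrac (fconst c))) t,
        rational_rank (value_group nu) s & (t + s)%N = n].

Definition wdeg (R : realType) n (w : 'I_n -> R) (m : multinom n) : R :=
  \sum_j w j *+ m j.

Definition monomial_val (R : realType) n (k : fieldType) (w : 'I_n -> R)
    (f : mfps n k) : \bar R :=
  ereal_inf [set (wdeg w m)%:E | m in [set m | fcoef f m != 0]].

Section Completion.
Context {R : realType} {K F : fieldType}.
Implicit Types (nu : K -> \bar R) (nuhat : F -> \bar R).

Definition val_cauchy nuhat (u : nat -> F) := forall lam : R, exists N,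
  forall i j, (N <= i)%N -> (N <= j)%N -> (lam%:E <= nuhat (u i - u j)%R)%E.

Definition val_cvg nuhat (u : nat -> F) (l : F) := forall lam : R, exists N,
  forall i, (N <= i)%N -> (lam%:E <= nuhat (l - u i)%R)%E.

(* The subring {nuhat >= 0} of F is the completion of {nu >= 0} for the topology
   of the ideals {nu >= lam}; F is the fraction field of {nuhat >= 0} because
   nuhat is a valuation on F. *)
Record val_completion nu (iota : {rmorphism K -> F}) nuhat : Prop :=
  ValCompletion {
  completion_val : valuation nuhat;
  completion_ext : extends_val iota nu nuhat;
  completion_dense : forall x, val_ring nuhat x -> forall lam : R,
    exists2 y, val_ring nu y & (lam%:E <= nuhat (x - iota y)%R)%E;
  completion_complete : forall u : nat -> F,
    (forall i, val_ring nuhat (u i)) -> val_cauchy nuhat u ->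
    exists2 l, val_ring nuhat l & val_cvg nuhat u l }.

End Completion.

Record val_closure (R : realType) (F : fieldType) (nuhat : F -> \bar R)
    (Omega : closedFieldType) (emb : {rmorphism F -> Omega})
    (nubar : Omega -> \bar R) : Prop := ValClosure {
  closure_alg : forall x, algebraicOver emb x;
  closure_val : valuation nubar;
  closure_ext : extends_val emb nuhat nubar }.

Section Supports.
Context {R : realType} {n : nat} {k : fieldType} {Khat : fieldType}.
Local Notation K := {fraction mfps n k}.
Variables (nu : K -> \bar R) (iota : {rmorphism K -> Khat})
  (nuhat : Khat -> \bar R).

Definition poly_frac (p : mpoly n k) : K := tofrac (mfps_of_mpoly p).

Record uniformization := Uniformization {
  un_A : idomainType;
  un_r : nat;
  un_m : set un_A;
  un_z : 'I_un_r -> un_A;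
  un_regular : regular_system un_m un_z;
  (* k[x] -> A is injective and induces an isomorphism Frac A = k(x); un_frac
     is the resulting embedding of A in Frac k[[x]]. *)
  un_poly : {rmorphism mpoly n k -> un_A};
  un_frac : {rmorphism un_A -> K};
  un_polyE : forall p, un_frac (un_poly p) = poly_frac p;
  un_poly_inj : injective un_poly;
  un_birational : forall a, exists p q, q != 0 /\ a * un_poly q = un_poly p;
  un_wt : 'I_un_r -> R;
  un_wtE : forall j, nu (un_frac (un_z j)) = (un_wt j)%:E;
  un_wt_gt0 : forall j, 0 < un_wt j;
  un_wt_free : forall g, value_group nu g ->
    exists! b : {ffun 'I_un_r -> int}, g = \sum_j un_wt j *~ b j;
  (* {nuhat >= 0} is also the completion of the valuation ring of nu on
     Frac A. *)
  un_dense : forall x, val_ring nuhat x -> forall lam : R,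
    exists a b : un_A, [/\ b != 0, val_ring nu (un_frac a / un_frac b) &
      (lam%:E <= nuhat (x - iota (un_frac a / un_frac b))%R)%E];
  (* The m-adic completion of A is L[[z]]; in particular fcoef0 \o un_psi
     identifies L with A/m, and the last condition is tr.deg_k L = n - r. *)
  un_L : fieldType;
  un_psi : {rmorphism un_A -> mfps un_r un_L};
  un_completion : adic_completion un_m [set f | fcoef0 f = 0] un_psi;
  un_psi_z : forall j, un_psi (un_z j) = fX j;
  un_trdeg : exists2 t,
    trdeg (fun c : k => fcoef0 (un_psi (un_poly (mpolyC n c)))) t &
    (t + un_r)%N = n;
  (* The completion of A embeds in Khat over A, and nuhat is monomial on
     it. *)
  un_theta : {rmorphism mfps un_r un_L -> Khat};
  un_thetaE : forall a, un_theta (un_psi a) = iota (un_frac a);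
  un_monomial : forall f, nuhat (un_theta f) = monomial_val un_wt f }.

(* The possible nonzero terms of degree i in an expansion: elements of
   L.z^b with b_1 nu(z_1) + ... + b_r nu(z_r) = i. *)
Definition uniformized_terms (U : uniformization) (i : R) : set Khat :=
  [set w | exists (c : un_L U) (b : 'I_(un_r U) -> int),
     \sum_j un_wt j *~ b j = i /\
     w = un_theta U (fconst c) *
         \prod_j iota (un_frac U (un_z j)) ^ b j].

Definition whomog (alpha : 'I_n -> R) (p : mpoly n k) :=
  exists s, forall m, m \in msupp p -> wdeg alpha m = s.

Definition homogeneous_terms (alpha : 'I_n -> R) (i : R) : set Khat :=
  [set w | w = 0 \/ exists a b : mpoly n k,
     [/\ a != 0, b != 0, whomog alpha a /\ whomog alpha b,
         (nu (poly_frac a) - nu (poly_frac b))%E = i%:E &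
         w = iota (poly_frac a / poly_frac b)]].

(* x = sum_i w_i, with support {i | w_i <> 0} in Gamma^+ and without
   accumulation point (hence countable, and with finitely many elements below
   any bound, so that the partial sums below are finite). *)
Record expansion (terms : R -> set Khat) (x : Khat) (w : R -> Khat) : Prop :=
  Expansion {
  exp_terms : forall i, w i != 0 -> terms i (w i);
  exp_supp : forall i, w i != 0 -> 0 <= i /\ value_group nu i;
  exp_discrete : limit_point [set i | w i != 0] = set0;
  exp_sum : forall mu : R, exists lam0, forall lam, lam0 <= lam ->
    (mu%:E <= nuhat (x - \sum_(i \in [set i | i < lam]) w i)%R)%E }.

(* Sums of generators, including the empty sum: adding 0 to the generators of
   a sub-semigroup of the nonnegative reals shows that this makes no
   difference below. *)
Definition semigroup_gen s (g : 'I_s -> R) : set R :=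
  [set i | exists c : 'I_s -> nat, i = \sum_j g j *+ c j].

Definition Vhat : set Khat := val_ring nuhat.

Definition Valg : set Khat := [set x | Vhat x /\ algebraicOver iota x].

Definition Vfg (terms : R -> set Khat) : set Khat :=
  [set x | Vhat x /\ exists w, expansion terms x w /\
     exists s (g : 'I_s -> R),
       (forall j, 0 <= g j) /\ [set i | w i != 0] `<=` semigroup_gen g].

(* The rings of coefficients: V^fg, for the supports given by a choice of A, z
   and L or, when nu is monomial, by weighted homogeneous fractions; V^alg;
   and the completion itself. *)
Variant coefficient_ring : set Khat -> Prop :=
| FgRing (U : uniformization) : coefficient_ring (Vfg (uniformized_terms U))
| FgRingMonomial (alpha : 'I_n -> R) of
    (forall j, 0 < alpha j) &
    (forall f : mfps n k, nu (tofrac f) = monomial_val alpha f) :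
    coefficient_ring (Vfg (homogeneous_terms alpha))
| AlgRing : coefficient_ring Valg
| HatRing : coefficient_ring Vhat.

End Supports.

Section Factorization.
Context {F : fieldType} (V : set F).
Implicit Types (p q : {poly F}).

Definition poly_over p := forall i, V p`_i.

Definition poly_unit p := exists2 q, poly_over q & p * q = 1.

Definition irreducible_over p :=
  [/\ poly_over p, p != 0, ~ poly_unit p &
      forall q1 q2, poly_over q1 -> poly_over q2 -> p = q1 * q2 ->
        poly_unit q1 \/ poly_unit q2].

Definition no_multiple_factor p :=
  forall q1 q2, poly_over q1 -> poly_over q2 -> p = q1 ^+ 2 * q2 ->
    poly_unit q1.

End Factorization.

(* Main.v *)
Require Import Defs.
From HB Require Import structures.
From mathcomp Require Import all_boot all_order all_algebra separable.
From mathcomp Require Import boolp classical_sets cardinality fsbigop topology.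
From mathcomp Require Import reals constructive_ereal ereal normedtype.
From mathcomp.multinomials Require Import -(notations) mpoly.
From mathcomp Require Import lra ring zify.

(** Suppose Q <> P and let eps = nu(Q - P) / d. At a root z_i of P, the value
    Q(z_i) = (Q - P)(z_i) has valuation at least nu(Q - P), and it is the product
    of the d differences between z_i and the roots of Q; so some root w_i of Q
    satisfies nubar(z_i - w_i) >= eps. By hypothesis z_i - z_j has valuation less
    than eps for i <> j; hence the w_i are distinct, and they are all the roots
    of Q (close_roots).

    This matching of roots is compatible with conjugation over the completed
    field, because conjugation preserves nubar (conjugate_val, a consequence of
    completeness). This is Krasner's argument: if the product of the X - z_i over
    a set of indices has coefficients in the completed field, then so does the
    product of the X - w_i over the same set (krasner_transfer). The factor Q_i
    is the product of the X - w_j over the j such that z_j is a root of P_i. As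
    the matching is symmetric, a factorization of Q_i would give one of P_i
    (irreducible_transfer); the estimate for Q_i - P_i follows from
    nubar(z_j - w_j) >= eps (prod_XsubC_diff).

    It remains to see that the polynomials obtained have coefficients in the
    coefficient ring V. These coefficients are integral over V, being polynomials
    in roots of P or Q (coef_factor_integral), and V contains the elements of the
    completed valuation ring that are algebraic over V (closed_subring). The
    latter is immediate for the completion and for the ring of algebraic
    elements.

    For the elements with finitely generated support (fgring), it is Newton's
    method with control of the supports. The terms of an expansion form a system
    closed under products and inverses (term_system), and an element has its
    support in a semigroup S when it is a limit of finite sums of terms with
    degrees in S. Around a good approximation y of a simple root x of p, with t
    the leading term of p'(y), the equation for u = (x - y) / t is a contraction
    with coefficients of support in one finitely generated semigroup
    (fgring_simple_root), so that u has its support there (cl_fixpoint). The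
    divisions by t are harmless, because the nonnegative part of a shifted
    finitely generated semigroup lies in a finitely generated semigroup
    (sgen_shift). *)

Set Implicit Arguments.
Unset Strict Implicit.
Unset Printing Implicit Defensive.

Import Order.TTheory GRing.Theory Num.Theory numFieldNormedType.Exports.

Local Open Scope classical_set_scope.
Local Open Scope ring_scope.

(** * Real valuations *)

Section ValuationTheory.
Context {R : realType} {K : fieldType} {v : K -> \bar R}.
Hypothesis vP : valuation v.
Implicit Types (a b : R) (x y : K).

Lemma val0 : v 0 = +oo%E. Proof. by case: vP. Qed.

Lemma val_fin x : x != 0 -> exists a, v x = a%:E.
Proof. by case: vP => _ f _ _ /f/fineK <-; exists (fine (v x)). Qed.

Lemma valM x y : v (x * y) = (v x + v y)%E.
Proof. by case: vP. Qed.

Lemma val1 : v 1 = 0%E.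
Proof.
have [a va] := val_fin (oner_neq0 K).
have := valM 1 1; rewrite mulr1 va => -[/eqP].
by rewrite -subr_eq subrr => /eqP <-.
Qed.

Lemma valN x : v (- x) = v x.
Proof.
suff vN1 : v (-1) = 0%E by rewrite -mulN1r valM vN1 add0e.
have N10 : -1 != 0 :> K by rewrite oppr_eq0 oner_neq0.
have [a va] := val_fin N10.
have := valM (-1) (-1); rewrite mulrNN mulr1 val1 va => -[/eqP].
by rewrite eq_sym -mulr2n mulrn_eq0 /= => /eqP ->.
Qed.

Lemma valX x a n : v x = a%:E -> v (x ^+ n) = (a *+ n)%:E.
Proof.
by move=> vx; elim: n => [|n IH]; rewrite ?val1 // exprS valM vx IH mulrS.
Qed.

Lemma valV x a : v x = a%:E -> v x^-1 = (- a)%:E.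
Proof.
move=> vx; have x0 : x != 0 by apply/eqP => x0; move: vx; rewrite x0 val0.
have [b vb] := val_fin (invr_neq0 x0).
have := valM x x^-1; rewrite divff // val1 vx vb => -[/esym/eqP].
by rewrite addrC addr_eq0 => /eqP ->.
Qed.

Lemma valD_ge a x y : (a%:E <= v x)%E -> (a%:E <= v y)%E ->
  (a%:E <= v (x + y)%R)%E.
Proof.
case: vP => _ _ _ vD ax ay; apply: le_trans (vD x y).
by rewrite le_min ax ay.
Qed.

Lemma valB_ge a x y : (a%:E <= v x)%E -> (a%:E <= v y)%E ->
  (a%:E <= v (x - y)%R)%E.
Proof. by move=> ax ay; apply: valD_ge; rewrite ?valN. Qed.

Lemma valBC x y : v (x - y) = v (y - x).
Proof. by rewrite -opprB valN. Qed.

Lemma val_trans a y x z : (a%:E <= v (x - y)%R)%E -> (a%:E <= v (y - z)%R)%E ->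
  (a%:E <= v (x - z)%R)%E.
Proof. by move=> ax az; have := valD_ge ax az; rewrite addrA subrK. Qed.

Lemma valD_gt a x y : (a%:E < v x)%E -> (a%:E < v y)%E ->
  (a%:E < v (x + y)%R)%E.
Proof.
case: vP => _ _ _ vD ax ay; apply: lt_le_trans (vD x y).
by rewrite lt_min ax ay.
Qed.

Lemma val_sum_ge a (I : Type) (s : seq I) (P : pred I) (F : I -> K) :
  (forall i, P i -> (a%:E <= v (F i))%E) ->
  (a%:E <= v (\sum_(i <- s | P i) F i)%R)%E.
Proof.
move=> aF; elim/big_ind: _ => //; first by rewrite val0 leey.
by move=> x y; apply: valD_ge.
Qed.

Lemma valM_ge a b x y : (a%:E <= v x)%E -> (b%:E <= v y)%E ->
  ((a + b)%:E <= v (x * y)%R)%E.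
Proof. by move=> ax bY; rewrite valM EFinD leeD. Qed.

Lemma valM0_ge a x y : (a%:E <= v x)%E -> (0 <= v y)%E ->
  (a%:E <= v (x * y)%R)%E.
Proof. by move=> ax bY; rewrite -[a]addr0; apply: valM_ge. Qed.

Lemma valX_ge a x n : (a%:E <= v x)%E -> ((a *+ n)%:E <= v (x ^+ n)%R)%E.
Proof.
move=> ax; elim: n => [|n IH]; first by rewrite val1.
by rewrite exprS mulrS; apply: valM_ge.
Qed.

Lemma valX0_ge x n : (0 <= v x)%E -> (0 <= v (x ^+ n)%R)%E.
Proof. by move=> /(valX_ge n); rewrite mul0rn. Qed.

Lemma val_horner_ge a (p : {poly K}) x : (forall i, (a%:E <= v p`_i)%E) ->
  (0 <= v x)%E -> (a%:E <= v p.[x])%E.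
Proof.
move=> ap x0; rewrite horner_coef; apply: val_sum_ge => i _.
by apply: valM0_ge; rewrite // valX0_ge.
Qed.

(** The dominant term of a sum decides its valuation. *)
Lemma val_dominant a x y : v x = a%:E -> (a%:E < v (y - x)%R)%E -> v y = a%:E.
Proof.
move=> vx lt; apply/eqP; rewrite eq_le; apply/andP; split; last first.
  by rewrite -[y](subrK x); apply: valD_ge; rewrite ?vx // ltW.
rewrite leNgt; apply/negP => gt.
have := valD_gt gt (_ : a%:E < v (x - y)%R)%E.
by rewrite valBC => /(_ lt); rewrite addrC subrK vx ltxx.
Qed.

Lemma val_eq_infty x : (forall a, (a%:E <= v x)%E) -> x = 0.
Proof.
move=> h; apply/eqP/negPn/negP => /val_fin[a va].
by have := h (a + 1); rewrite va lee_fin gerDl ler10.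
Qed.

Lemma val_neq0 x a : v x = a%:E -> x != 0.
Proof. by move=> vx; apply/eqP => x0; move: vx; rewrite x0 val0. Qed.

Lemma val_bounded x : exists a, (a%:E <= v x)%E.
Proof.
have [->|/val_fin[a ->]] := eqVneq x 0; first by exists 0; rewrite val0 leey.
by exists a.
Qed.

Lemma val_seq_bounded (s : seq K) :
  exists2 a, a <= 0 & forall x, x \in s -> (a%:E <= v x)%E.
Proof.
elim: s => [|x s [a a0 IH]]; first by exists 0.
have [b bx] := val_bounded x.
exists (Num.min a b); first by rewrite ge_min a0.
move=> y; rewrite inE => /orP[/eqP ->|/IH].
  by apply: le_trans bx; rewrite lee_fin ge_min lexx orbT.
by apply: le_trans; rewrite lee_fin ge_min lexx.
Qed.

Lemma poly_valP a (p : {poly K}) :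
  (a%:E <= poly_val v p)%E <-> forall i, (a%:E <= v p`_i)%E.
Proof.
split=> [h i|h]; last first.
  rewrite /poly_val; elim/big_ind: _ => //; first by rewrite leey.
  by move=> x y ax ay; rewrite le_min ax ay.
have [lti|gei] := ltnP i (size p); last by rewrite nth_default // val0 leey.
apply: le_trans h _; rewrite /poly_val.
by rewrite (bigD1 (Ordinal lti)) //= ge_min lexx.
Qed.

Lemma val_coef_prod_XsubC (n : nat) (I : Type) (s : seq I) (z : I -> K) :
  (forall i, (0 <= v (z i))%E) ->
  (0 <= v (\prod_(i <- s) ('X - (z i)%:P))`_n)%E.
Proof.
move=> z0; elim: s n => [|i s IH] n.
  by rewrite big_nil coef1; case: n => [|n]; rewrite ?val1 ?val0 ?leey.
rewrite big_cons mulrBl coefB coefXM coefCM; apply: valB_ge.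
  by case: n => [|n] //=; rewrite val0 leey.
by rewrite mulrC; apply: valM0_ge.
Qed.

End ValuationTheory.

(** * Conjugate elements over a complete field have the same valuation *)

Section ConjugateValuations.
Context {R : realType} {F : fieldType} {nuhat : F -> \bar R}.
Context {Omega : fieldType} {emb : {rmorphism F -> Omega}}.
Context {nubar : Omega -> \bar R}.
Hypotheses (nuhatP : valuation nuhat) (nubarP : valuation nubar).
Hypothesis nubar_ext : extends_val emb nuhat nubar.
Hypothesis complete : forall u : nat -> F, val_cauchy nuhat u ->
  exists l, val_cvg nuhat u l.
Implicit Types (p q mu c : {poly F}) (th : Omega).

Definition ev th : {poly F} -> Omega := horner_eval th \o map_poly emb.

Lemma evE th p : ev th p = (map_poly emb p).[th].
Proof. by []. Qed.

HB.instance Definition _ th := GRing.RMorphism.on (ev th).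

Lemma evC th a : ev th a%:P = emb a.
Proof. by rewrite evE map_polyC hornerC. Qed.

Lemma evXn th m : ev th 'X^m = th ^+ m.
Proof. by rewrite evE map_polyXn hornerXn. Qed.

Lemma ev_coef th p m : (size p <= m)%N ->
  ev th p = \sum_(i < m) emb p`_i * th ^+ i.
Proof.
move=> sp; rewrite evE (@horner_coef_wide _ m) ?size_map_poly //.
by apply: eq_bigr => i _; rewrite coef_map.
Qed.

(** The relations between values at th are the multiples of mu; they are
    therefore the same at every root of mu. *)
Lemma irreducible_root mu th p : irreducible_poly mu -> ev th mu = 0 ->
  (ev th p == 0) = (mu %| p).
Proof.
move=> irr mu0; apply/idP/idP => [p0|/dvdpP[q ->]]; last first.
  by rewrite rmorphM /= mu0 mulr0.
apply/negPn; rewrite -irreducible_poly_coprime // -(coprimep_map emb).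
by apply/negP => /coprimep_root/(_ (introT eqP mu0)); rewrite -evE p0.
Qed.

Lemma ev_modp mu th p : ev th mu = 0 -> ev th (p %% mu) = ev th p.
Proof. by move=> mu0; rewrite {2}(divp_eq p mu) rmorphD rmorphM /= mu0 mulr0 add0r. Qed.

Lemma ev_ge th (a b : R) m p : (size p <= m)%N ->
  (forall i, (i < m)%N -> (b%:E <= nubar (th ^+ i))%E) ->
  (forall i, (a%:E <= nuhat p`_i)%E) -> ((a + b)%:E <= nubar (ev th p))%E.
Proof.
move=> sp hb ha; rewrite (ev_coef _ sp); apply: (val_sum_ge nubarP) => i _.
by apply: (valM_ge nubarP); rewrite ?nubar_ext //; apply: hb.
Qed.

Lemma powers_bounded th m :
  exists b : R, forall i, (i < m)%N -> (b%:E <= nubar (th ^+ i))%E.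
Proof.
have [b _ hb] := val_seq_bounded nubarP [seq th ^+ i | i <- iota 0 m].
by exists b => i im; apply: hb; apply: map_f; rewrite mem_iota.
Qed.

Lemma eventually_coef (u : nat -> {poly F}) (L : nat -> F) (m : nat) (a : R) :
  (forall i, val_cvg nuhat (fun k => (u k)`_i) (L i)) ->
  exists N, forall k i, (N <= k)%N -> (i < m)%N ->
    (a%:E <= nuhat (L i - (u k)`_i)%R)%E.
Proof.
move=> cv; elim: m => [|m [N hN]]; first by exists 0%N.
have [M hM] := cv m a; exists (maxn N M) => k i.
rewrite geq_max => /andP[Nk Mk]; rewrite ltnS leq_eqVlt => /orP[/eqP ->|im].
  exact: hM.
exact: hN.
Qed.

(** Equivalence of norms: on the span of 1, th, ..., th^(m-1), the valuation of
    the value is, up to a constant, the least valuation of the coordinates.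
    By induction on m, the span of the first m powers is complete, hence closed,
    so that th^m stays at a bounded distance from it; this bounds the last
    coordinate, then the others. *)
Lemma power_basis_bounded th m :
  (forall p, p != 0 -> (size p <= m)%N -> ev th p != 0) ->
  exists C : R, forall p a, (size p <= m)%N -> (a%:E <= nubar (ev th p))%E ->
    forall i, ((a - C)%:E <= nuhat p`_i)%E.
Proof.
elim: m => [|m IH] free.
  exists 0 => p a; rewrite leqn0 size_poly_eq0 => /eqP -> _ i.
  by rewrite coef0 (val0 nuhatP) leey.
have [p p0 pm|C hC] := IH; first by apply: free => //; apply: leqW.
have [b hb] := powers_bounded th m.
(* If D did not exist, th^m would be the limit of a sequence of the span. *)
have [D hD] : exists D : R, forall w : {poly F}, (size w <= m)%N ->
    (nubar (th ^+ m + ev th w)%R < D%:E)%E.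
  apply: contrapT => /forallNP noD.
  have /choice[w hw] : forall k : nat, exists w : {poly F}, (size w <= m)%N /\
      (k%:R%:E <= nubar (th ^+ m + ev th w)%R)%E.
    move=> k; apply: contrapT => /forallNP now; apply: (noD k%:R) => w sw.
    by rewrite ltNge; apply/negP => le; apply: (now w).
  have sw k : (size (w k) <= m)%N by have [] := hw k.
  have cau i : val_cauchy nuhat (fun k => (w k)`_i).
    move=> a; pose N := (Num.trunc (a + C)).+1; exists N => j l Nj Nl.
    rewrite -coefB -[a](addrK C).
    apply: (hC (w j - w l)).
      by rewrite (leq_trans (size_polyD _ _)) // size_polyN geq_max !sw.
    have big k : (N <= k)%N ->
        ((a + C)%:E <= nubar (th ^+ m + ev th (w k))%R)%E.
      move=> Nk; have [_] := hw k; apply: le_trans; rewrite lee_fin.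
      by apply: le_trans (ltW (truncnS_gt _)) _; rewrite ler_nat.
    have := valB_ge nubarP (big _ Nj) (big _ Nl).
    by rewrite opprD addrACA subrr add0r -rmorphB.
  have /choice[L hL] : forall i, exists l, val_cvg nuhat (fun k => (w k)`_i) l.
    by move=> i; apply: complete.
  pose W := \poly_(i < m) L i.
  have sW : (size W <= m)%N by apply: size_poly.
  have sX : size ('X^m + W) = m.+1.
    by rewrite size_polyDl size_polyXn // ltnS.
  suff : ev th ('X^m + W) = 0.
    by apply/eqP/free; rewrite ?sX // -size_poly_eq0 sX.
  apply: (val_eq_infty nubarP) => a.
  have [N hN] := eventually_coef m (a - b) hL.
  pose k := maxn N (Num.trunc a).+1.
  have -> : ev th ('X^m + W) =
      (th ^+ m + ev th (w k)) + ev th (W - w k).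
    rewrite rmorphB rmorphD /= evXn.
    by rewrite -addrA [_ (w k) + _]addrC subrK.
  apply: (valD_ge nubarP).
    have [_] := hw k; apply: le_trans; rewrite lee_fin.
    by apply: le_trans (ltW (truncnS_gt _)) _; rewrite ler_nat leq_maxr.
  rewrite -[a](subrK b); apply: (@ev_ge th (a - b) b m) => // [|i].
    by rewrite (leq_trans (size_polyD _ _)) // size_polyN geq_max sW sw.
  rewrite coefB coef_poly; case: ltnP => im; first by rewrite hN ?leq_maxl.
  by rewrite nth_default ?subrr ?(val0 nuhatP) ?leey // (leq_trans (sw k)).
have [b' hb'] := powers_bounded th m.+1.
pose D' := Num.max 0 (Num.max D (D - b')).
have D'0 : 0 <= D' by rewrite le_max lexx.
have D'D : D <= D' by rewrite !le_max lexx orbT.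
have D'b : D - b' <= D' by rewrite !le_max lexx !orbT.
exists (Num.max D' (D' + C)) => p a sp ap.
pose cm := p`_m; pose p' := take_poly m p.
have sp' : (size p' <= m)%N by apply: size_take_poly.
have pE : p = p' + cm *: 'X^m.
  apply/polyP => i; rewrite coefD coef_take_poly coefZ coefXn.
  have [im|mi] := ltnP i m; first by rewrite ltn_eqF // mulr0 addr0.
  have [-> |ne] := eqVneq i m; first by rewrite mulr1 add0r.
  by rewrite mulr0 addr0 nth_default // (leq_trans sp) // ltn_neqAle eq_sym ne.
have epE : ev th p = ev th p' + emb cm * th ^+ m.
  by rewrite {1}pE rmorphD /= -mul_polyC rmorphM /= evXn evC.
have cm_ge : ((a - D)%:E <= nuhat cm)%E.
  have [->|cm0] := eqVneq cm 0; first by rewrite (val0 nuhatP) leey.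
  have [e ve] := val_fin nuhatP cm0; rewrite ve lee_fin lerBlDr.
  have := hD (cm^-1 *: p') (leq_trans (size_scale_leq _ _) sp').
  have -> : th ^+ m + ev th (cm^-1 *: p') = (emb cm)^-1 * ev th p.
    rewrite epE mulrDr mulKf ?fmorph_eq0 // addrC; congr (_ + _).
    by rewrite -mul_polyC rmorphM /= evC fmorphV.
  move=> lt; have vVe : nubar (emb cm)^-1 = (- e)%:E.
    by apply: (valV nubarP); rewrite nubar_ext.
  have := valM_ge nubarP (_ : ((- e)%:E <= nubar (emb cm)^-1)%E) ap.
  rewrite vVe => /(_ (lexx _)) /le_lt_trans /(_ lt).
  by rewrite lte_fin addrC ltrBlDr addrC => /ltW.
have p'_ge i : ((a - D' - C)%:E <= nuhat p'`_i)%E.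
  apply: hC sp' _ i; have -> : ev th p' = ev th p - emb cm * th ^+ m.
    by rewrite epE addrK.
  apply: (valB_ge nubarP); first by apply: le_trans ap; rewrite lee_fin gerBl.
  have := valM_ge nubarP (_ : ((a - D)%:E <= nubar (emb cm))%E) (hb' m (ltnSn m)).
  by rewrite nubar_ext => /(_ cm_ge); apply: le_trans; rewrite lee_fin; lra.
move=> i; rewrite pE coefD coefZ coefXn.
apply: (valD_ge nuhatP).
  apply: le_trans (p'_ge i); rewrite lee_fin -addrA -opprD lerD2l lerN2.
  by rewrite le_max lexx orbT.
case: eqP => _; last by rewrite mulr0 (val0 nuhatP) leey.
rewrite mulr1; apply: le_trans cm_ge; rewrite lee_fin lerD2l lerN2.
by rewrite !le_max !lexx !orbT.
Qed.

(** Both values are bounded by the coordinates of c in the power basis, up to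
    constants. Applied to c^k, the bound holds for k times the valuations with
    the same constants, which are lost in the limit. *)
Lemma conjugate_val_le mu th th' c :
  irreducible_poly mu -> ev th mu = 0 -> ev th' mu = 0 ->
  (nubar (ev th c) <= nubar (ev th' c))%E.
Proof.
move=> irr mu0 mu0'; have munz := irredp_neq0 irr.
have [c0|c0] := eqVneq (ev th' c) 0; first by rewrite c0 (val0 nubarP) leey.
have d0 : ev th c != 0.
  by rewrite (irreducible_root _ irr mu0) -(irreducible_root _ irr mu0').
have [b vb] := val_fin nubarP c0; have [a va] := val_fin nubarP d0.
pose m := (size mu).-1.
have smu : size mu = m.+1 by rewrite prednK // size_poly_gt0.
have [p pnz sp|C hC] := @power_basis_bounded th m.
  rewrite (irreducible_root _ irr mu0); apply/negP => /(dvdp_leq pnz).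
  by rewrite smu ltnNge sp.
have [e he] := powers_bounded th' m.
have key k : a *+ k - C + e <= b *+ k.
  pose p := c ^+ k %% mu.
  have sp : (size p <= m)%N by rewrite -ltnS -smu ltn_modpN0.
  rewrite -lee_fin -(valX nubarP k vb) -rmorphXn /= -(ev_modp _ mu0').
  apply: (ev_ge sp he); apply: (hC _ _ sp).
  by rewrite ev_modp // rmorphXn /= (valX nubarP k va).
rewrite vb va lee_fin leNgt; apply/negP => ba.
pose k := (Num.trunc ((C - e) / (a - b))).+1.
have : (C - e) / (a - b) < k%:R by apply: truncnS_gt.
rewrite ltr_pdivrMr ?subr_gt0 // mulrC mulr_natr mulrnBl.
by have := key k; lra.
Qed.

Lemma conjugate_val mu th th' c :
  irreducible_poly mu -> ev th mu = 0 -> ev th' mu = 0 ->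
  nubar (ev th c) = nubar (ev th' c).
Proof.
by move=> irr h h'; apply/eqP; rewrite eq_le !(@conjugate_val_le mu).
Qed.

End ConjugateValuations.
Arguments ev {F Omega} emb th _ : simpl never.

(** * Krasner's lemma for groups of roots *)

Section RootTransfer.
Context {R : realType} {F : fieldType} {nuhat : F -> \bar R}.
Context {Omega : closedFieldType} {emb : {rmorphism F -> Omega}}.
Context {nubar : Omega -> \bar R}.
Hypotheses (nuhatP : valuation nuhat) (nubarP : valuation nubar).
Hypothesis nubar_ext : extends_val emb nuhat nubar.
Hypothesis complete : forall u : nat -> F, val_cauchy nuhat u ->
  exists l, val_cvg nuhat u l.
Hypothesis emb_alg : forall x, algebraicOver emb x.
Hypothesis char0 : [pchar F] =i pred0.
Implicit Types (p q mu c : {poly F}) (th : Omega).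

Local Notation ev := (ev emb).

Lemma ev_comp th p q : ev th (p \Po q) = ev (ev th q) p.
Proof. by rewrite !evE map_comp_poly horner_comp. Qed.

Lemma primitive_element (s : seq Omega) :
  exists th, forall x, x \in s -> exists p, ev th p = x.
Proof.
elim: s => [|x s [y IH]]; first by exists 0.
have [p p0 px] := emb_alg x; have [q q0 qy] := emb_alg y.
have [n /= [[a ax] [b bY]]] := pchar0_PET p0 px q0 qy char0.
exists (y *+ n - x) => t; rewrite inE => /orP[/eqP ->|/IH[c <-]].
  by exists a.
by exists (c \Po b); rewrite ev_comp (evE _ b) bY.
Qed.

Lemma irreducible_annihilator th :
  exists2 mu, irreducible_poly mu & ev th mu = 0.
Proof.
pose Pn n := `[< exists p, [/\ p != 0, ev th p = 0 & size p = n] >].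
have [p0 p0nz /eqP p0th] := emb_alg th.
have exn : exists n, Pn n by exists (size p0); apply/asboolP; exists p0.
case: (ex_minnP exn) => n /asboolP[mu [munz muth sz]] min.
have le_mu q : q != 0 -> ev th q = 0 -> (size mu <= size q)%N.
  by move=> qnz qth; rewrite sz; apply: min; apply/asboolP; exists q.
exists mu => //; split.
  rewrite ltnNge; apply/negP => /size1_polyC mu_const.
  move: muth munz; rewrite mu_const evC => /eqP.
  by rewrite fmorph_eq0 polyC_eq0 => ->.
move=> q sq qmu; have qnz := dvdpN0 qmu munz.
rewrite -dvdp_size_eqp // eqn_leq dvdp_leq //=.
have /dvdpP[r mu_rq] := qmu.
have /eqP := muth; rewrite {1}mu_rq rmorphM mulf_eq0 => /orP[]/eqP h; last exact: le_mu.
have rnz : r != 0 by apply/eqP => r0; move: munz; rewrite mu_rq r0 mul0r eqxx.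
have := le_mu _ rnz h; rewrite mu_rq size_mul // => le.
have r0 : (0 < size r)%N by rewrite size_poly_gt0.
have q0 : (0 < size q)%N by rewrite size_poly_gt0.
by move: (size r) (size q) r0 q0 sq le => [|i] [|[|j]] //; lia.
Qed.

Lemma conjugates_list mu : irreducible_poly mu ->
  exists rs : seq Omega, [/\ uniq rs, (size mu <= (size rs).+1)%N &
    forall th, th \in rs -> ev th mu = 0].
Proof.
move=> irr; have munz := irredp_neq0 irr.
have [rs muE] := closed_field_poly_normal (map_poly emb mu).
have lc0 : lead_coef (map_poly emb mu) != 0 by rewrite lead_coef_eq0 map_poly_eq0.
exists rs; split.
- rewrite -separable_prod_XsubC.
  have <- : separable_poly (map_poly emb mu) =
      separable_poly (\prod_(x <- rs) ('X - x%:P)).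
    by rewrite {1}muE; apply: eqp_separable; apply: eqp_scale.
  rewrite separable_map separable_poly.unlock irreducible_poly_coprime //; apply/negP => dv.
  have [sz _] := irr.
  have ltd : (size mu^`() < size mu)%N by apply: lt_size_deriv.
  have [d0|dnz] := eqVneq (mu^`()) 0; last first.
    by have := dvdp_leq dnz dv; rewrite leqNgt ltd.
  have /eqP := congr1 (fun p : {poly F} => p`_(size mu).-2) d0.
  have -> : (mu^`())`_(size mu).-2 = lead_coef mu *+ (size mu).-1.
    by rewrite coef_deriv lead_coefE; case: (size mu) sz => [|[]].
  rewrite coef0 -mulr_natr mulf_eq0 lead_coef_eq0 (negbTE munz) /=.
  by rewrite (proj1 (pcharf0P F) char0) -subn1 subn_eq0 leqNgt; case: irr => ->.
- by rewrite -(size_map_poly emb) muE size_scale // size_prod_XsubC.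
- move=> th; rewrite -root_prod_XsubC => /eqP h.
  by rewrite evE muE hornerZ h mulr0.
Qed.

(** Galois descent without automorphisms: the reduction of c modulo mu takes
    one value at more points than its degree, so it is constant. *)
Lemma conjugation_invariant mu th c x : irreducible_poly mu ->
  ev th mu = 0 -> (forall th', ev th' mu = 0 -> ev th' c = x) ->
  exists a, x = emb a.
Proof.
move=> irr muth inv; have munz := irredp_neq0 irr.
have [rs [urs srs hrs]] := conjugates_list irr.
pose r := c %% mu; pose h := map_poly emb r - x%:P.
have sh : (size h <= size rs)%N.
  have sr : (size r < size mu)%N by rewrite ltn_modp.
  have [big _] := irr.
  rewrite (leq_trans (size_polyD _ _)) // size_polyN geq_max size_map_poly.
  rewrite -ltnS (leq_trans sr) //= (leq_trans (size_polyC_leq1 _)) //.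
  by rewrite -ltnS (leq_trans big).
have h0 : h = 0.
  apply/eqP/negPn/negP => hnz; move: sh; rewrite leqNgt => /negP; apply.
  apply: (max_poly_roots hnz) => //; apply/allP => y /hrs muy.
  by rewrite /root !hornerE -evE ev_modp // inv ?subrr.
exists r`_0%N; move/eqP: h0; rewrite subr_eq0 => /eqP/polyP/(_ 0%N).
by rewrite coef_map coefC.
Qed.

Lemma prod_XsubC_root (I : eqType) (s : seq I) (z : I -> Omega) x :
  (\prod_(i <- s) ('X - (z i)%:P)).[x] = 0 -> exists2 i, i \in s & x = z i.
Proof.
move/eqP; rewrite horner_prod prodf_seq_eq0 => /hasP[i is_ /=].
by rewrite !hornerE subr_eq0 => /eqP ->; exists i.
Qed.

Section Close.
Variables (d : nat) (z w : 'I_d -> Omega) (P Q : {poly F}) (eps : R).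
Hypothesis Pz : map_poly emb P = \prod_(i < d) ('X - (z i)%:P).
Hypothesis Qw : map_poly emb Q = \prod_(i < d) ('X - (w i)%:P).
Hypothesis close : forall i, (eps%:E <= nubar (z i - w i)%R)%E.
Hypothesis sep : forall i j, i != j -> (nubar (z i - z j)%R < eps%:E)%E.

Lemma separated_inj : injective z.
Proof.
move=> i j zij; apply/eqP/negPn/negP => /sep.
by rewrite zij subrr (val0 nubarP) ltNge leey.
Qed.

Lemma close_index i j : (eps%:E <= nubar (z i - w j)%R)%E -> i = j.
Proof.
move=> h; apply/eqP/negPn/negP => /sep; rewrite ltNge => /negP; apply.
by apply: (val_trans nubarP h); rewrite (valBC nubarP).
Qed.

(** Write all the z_i and w_i as values at one primitive element th. Replacing
    th by a conjugate permutes the z_i and the w_i, and in the same way: it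
    preserves nubar, and w_i is the only root of Q close to z_i. If it preserves
    the set of the z_i over s, it preserves that of the w_i over s. *)
Lemma krasner_transfer (s : seq 'I_d) p : uniq s ->
  map_poly emb p = \prod_(i <- s) ('X - (z i)%:P) ->
  exists q, map_poly emb q = \prod_(i <- s) ('X - (w i)%:P).
Proof.
move=> us pz.
have [th prim] := primitive_element (codom z ++ codom w).
have [mu irr muth] := irreducible_annihilator th.
have /choice[a az] : forall i, exists c, ev th c = z i.
  by move=> i; apply: prim; rewrite mem_cat codom_f.
have /choice[b bw] : forall i, exists c, ev th c = w i.
  by move=> i; apply: prim; rewrite mem_cat codom_f orbT.
have rootP (I : eqType) (t : seq I) (y : I -> Omega) g c i th' : i \in t ->
    map_poly emb g = \prod_(i <- t) ('X - (y i)%:P) ->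
    ev th c = y i -> ev th' mu = 0 -> exists2 j, j \in t & ev th' c = y j.
  move=> it gE cy muth'; apply: prod_XsubC_root.
  rewrite -gE -evE -ev_comp; apply/eqP.
  rewrite (irreducible_root _ irr muth') -(irreducible_root _ irr muth).
  rewrite ev_comp cy evE gE horner_prod prodf_seq_eq0; apply/hasP; exists i => //=.
  by rewrite !hornerE subrr.
have perm th' : ev th' mu = 0 -> exists2 sg : 'I_d -> 'I_d, injective sg &
    forall i, ev th' (a i) = z (sg i) /\ ev th' (b i) = w (sg i).
  move=> muth'.
  have /choice[sg hsg] : forall i, exists j, ev th' (a i) = z j.
    move=> i; have [j _ hj] := rootP _ _ _ _ _ _ _ (mem_index_enum i) Pz (az i) muth'.
    by exists j.
  exists sg => [i j sij|i].
    apply: separated_inj; apply/eqP; rewrite -subr_eq0 -!az -rmorphB.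
    rewrite (irreducible_root _ irr muth) -(irreducible_root _ irr muth').
    by rewrite rmorphB /= !hsg sij subrr.
  split=> //.
  have [j _ hj] := rootP _ _ _ _ _ _ _ (mem_index_enum i) Qw (bw i) muth'.
  rewrite hj; congr w; apply/esym/close_index; rewrite -hj -hsg -rmorphB.
  rewrite (conjugate_val nuhatP nubarP nubar_ext complete _ irr muth' muth).
  by rewrite rmorphB /= az bw close.
(* The product over s of the X - w_i, before evaluation at th. *)
pose B : {poly {poly F}} := \prod_(i <- s) ('X - (b i)%:P).
have BE th' : map_poly (ev th') B = \prod_(i <- s) ('X - (ev th' (b i))%:P).
  rewrite rmorph_prod /=; apply: eq_bigr => i _.
  by rewrite rmorphB /= map_polyX map_polyC.
have inv th' : ev th' mu = 0 -> map_poly (ev th') B = \prod_(i <- s) ('X - (w i)%:P).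
  move=> muth'; have [sg sg_inj hsg] := perm _ muth'.
  have sgs : {subset map sg s <= s}.
    move=> _ /mapP[i is_ ->].
    have [j js] := rootP _ _ _ _ _ _ _ is_ pz (az i) muth'.
    by rewrite (hsg i).1 => /separated_inj ->.
  have pe : perm_eq (map sg s) s.
    apply: uniq_perm; rewrite ?map_inj_uniq //.
    have [] := @uniq_min_size _ (map sg s) s; rewrite ?map_inj_uniq ?size_map //.
  rewrite BE -[RHS](perm_big _ pe) big_map /=.
  by apply: eq_bigr => i _; rewrite (hsg i).2.
have /choice[q qE] : forall m, exists x,
    (\prod_(i <- s) ('X - (w i)%:P))`_m = emb x.
  move=> m; apply: (conjugation_invariant (c := B`_m) irr muth) => th' muth'.
  by rewrite -(inv _ muth') coef_map.
exists (\poly_(m < (size s).+1) q m); apply/polyP => m.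
rewrite coef_map /= coef_poly; case: ltnP => [_|ms]; first by rewrite -qE.
by rewrite rmorph0 nth_default // size_prod_XsubC.
Qed.

End Close.
End RootTransfer.

(** * Coefficient rings and factors *)

(** The common property of the three kinds of coefficient rings. By csr_alg,
    a monic factor over F of a monic polynomial over V is a polynomial over V:
    its coefficients are integral over V. *)
Record closed_subring (R : realType) (F : fieldType) (nuhat : F -> \bar R)
    (V : set F) : Prop := ClosedSubring {
  csr_ge0 : forall x, V x -> (0 <= nuhat x)%E;
  csr1 : V 1;
  csrB : forall x y, V x -> V y -> V (x - y);
  csrM : forall x y, V x -> V y -> V (x * y);
  csr_alg : forall x p, p != 0 -> poly_over V p -> root p x ->
    (0 <= nuhat x)%E -> V x }.

Section IntegralCoefficients.
Context {F Omega : fieldType} {emb : {rmorphism F -> Omega}} (V : set F).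
Hypotheses (V1 : V 1) (VB : forall x y, V x -> V y -> V (x - y)).
Hypothesis VM : forall x y, V x -> V y -> V (x * y).

Definition Vmem : {pred F} := fun x => `[< V x >].

Fact Vmem_subring : subring_closed Vmem.
Proof.
split=> [|x y|x y]; rewrite ?unfold_in; first exact/asboolP.
  by move=> /asboolP Vx /asboolP Vy; apply/asboolP/VB.
by move=> /asboolP Vx /asboolP Vy; apply/asboolP/VM.
Qed.

HB.instance Definition _ := GRing.isSubringClosed.Build F Vmem Vmem_subring.

(** V as a ring in its own right, over which integrality makes sense. *)
Record Vsub := VSub { Vval : F; Vsub_mem : Vval \in Vmem }.
HB.instance Definition _ := [isSub for Vval].
HB.instance Definition _ := [Choice of Vsub by <:].
HB.instance Definition _ := [SubChoice_isSubComNzRing of Vsub by <:].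

Lemma Vval_lift x : V x -> exists u : Vsub, val u = x.
Proof. by move=> /asboolP Vx; exists (@VSub x Vx). Qed.

(** The coefficients of q are polynomials in roots of Q, hence integral over
    V. *)
Lemma coef_factor_integral (Q q : {poly F}) (I : eqType) (t s : seq I)
    (w : I -> Omega) : Q \is monic -> poly_over V Q ->
  map_poly emb Q = \prod_(i <- t) ('X - (w i)%:P) ->
  map_poly emb q = \prod_(i <- s) ('X - (w i)%:P) ->
  {subset s <= t} ->
  forall m, exists p, [/\ p \is monic, poly_over V p & root p q`_m].
Proof.
move=> Qmon QV Qw qw ut m.
pose f : {rmorphism Vsub -> Omega} := emb \o (val : Vsub -> F).
have /choice[c cE] : forall i, exists u : Vsub, val u = Q`_i.
  by move=> i; apply: Vval_lift.
pose Q' : {poly Vsub} := \poly_(i < size Q) c i.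
have Q'E : map_poly val Q' = Q.
  apply/polyP => i; rewrite coef_map coef_poly; case: ltnP => [_|le].
    exact: cE.
  by rewrite [RHS]nth_default.
have Q'mon : Q' \is monic.
  rewrite monicE; apply/eqP/val_inj.
  rewrite -(lead_coef_map_inj val_inj (rmorph0 _)) Q'E rmorph1.
  exact/monicP.
have intw i : i \in s -> integralOver f (w i).
  move=> /ut ti; exists Q' => //; rewrite map_poly_comp Q'E Qw.
  rewrite /root horner_prod prodf_seq_eq0; apply/hasP; exists i => //=.
  by rewrite !hornerE subrr.
have [p pmon proot] : integralOver f (emb q`_m).
  have -> : emb q`_m = (map_poly emb q)`_m by rewrite coef_map.
  rewrite qw; elim: (s) m intw => [|i s' IH] m intw.
    by rewrite big_nil coef1; apply: integral_nat.
  have IH' m' : integralOver f (\prod_(i <- s') ('X - (w i)%:P))`_m'.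
    by apply: IH => j js; apply: intw; rewrite inE js orbT.
  rewrite big_cons mulrBl coefB coefXM coefCM; apply: integral_sub.
    by case: eqP => _; [exact: (integral0 f) | exact: IH'].
  by apply: integral_mul; [apply: intw; rewrite inE eqxx | apply: IH'].
exists (map_poly val p); split.
- by rewrite monicE (lead_coef_map_inj val_inj (rmorph0 _)) (monicP pmon) rmorph1.
- by move=> i; rewrite coef_map; case: (p`_i) => x /= /asboolP.
- by move: proot; rewrite map_poly_comp fmorph_root.
Qed.

End IntegralCoefficients.

Lemma poly_unit_size (F : fieldType) (V : set F) (p : {poly F}) :
  Defs.poly_unit V p -> size p = 1%N.
Proof.
by move=> [q _ pq]; apply/eqP; rewrite -dvdp1 -pq dvdp_mulr.
Qed.

Lemma monic_size1 (F : fieldType) (p : {poly F}) : p \is monic -> size p = 1%N -> p = 1.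
Proof.
move=> pmon /eqP; rewrite -dvdp1 => p1; apply/eqP.
rewrite -eqp_monic ?rpred1 //; apply/andP; split => //; exact: dvd1p.
Qed.

(** * Matching the roots of close polynomials *)

Section RootMatching.
Context {R : realType} {F : fieldType} {nuhat : F -> \bar R}.
Context {Omega : closedFieldType} {emb : {rmorphism F -> Omega}}.
Context {nubar : Omega -> \bar R}.
Hypotheses (nuhatP : valuation nuhat) (nubarP : valuation nubar).
Hypothesis nubar_ext : extends_val emb nuhat nubar.
Hypothesis complete : forall u : nat -> F, val_cauchy nuhat u ->
  exists l, val_cvg nuhat u l.
Hypothesis emb_alg : forall x, algebraicOver emb x.
Hypothesis char0 : [pchar F] =i pred0.
Context {V : set F}.
Hypothesis csr : closed_subring nuhat V.

(** If x had negative valuation, the leading term of p(x) would dominate. *)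
Lemma root_ge0 (p : {poly F}) x : p \is monic ->
  (forall i, (0 <= nuhat p`_i)%E) -> (map_poly emb p).[x] = 0 ->
  (0 <= nubar x)%E.
Proof.
move=> pmon p0 px; have [->|xnz] := eqVneq x 0; first by rewrite (val0 nubarP) leey.
have [a va] := val_fin nubarP xnz; rewrite va lee_fin leNgt; apply/negP => a0.
have pnz : p != 0 by apply: monic_neq0.
have sp : size p = (size p).-1.+1 by rewrite prednK // size_poly_gt0.
move: px; rewrite horner_coef size_map_poly sp big_ord_recr /=.
rewrite coef_map /= -/(lead_coef p) (monicP pmon) rmorph1 mul1r => /eqP.
rewrite addrC addr_eq0; set m := (size p).-1; move=> /eqP xm.
have := valX nubarP m va; rewrite xm (valN nubarP) => vm.
suff : ((a *+ m.-1)%:E <= (a *+ m)%:E)%E.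
  rewrite lee_fin; case: (m) xm => [|m'] xm; last first.
    by rewrite mulrS lerDr leNgt a0.
  by move/eqP: xm; rewrite big_ord0 oppr0 oner_eq0.
rewrite -vm; apply: (val_sum_ge nubarP) => i _.
have ilt : (i <= m.-1)%N by rewrite -ltnS (ltn_predK (ltn_ord i)).
have := valM_ge nubarP (_ : (0%:E <= nubar (emb p`_i))%E)
  (valX_ge nubarP i (_ : (a%:E <= nubar x)%E)).
rewrite coef_map nubar_ext va lexx => /(_ (p0 i) isT); apply: le_trans.
rewrite add0r lee_fin -(subnK ilt) mulrnDr gerDr.
by rewrite mulrn_wle0 // ltW.
Qed.

Lemma prod_XsubC_close (s : seq Omega) (x : Omega) (eps : R) : (0 < size s)%N ->
  ((eps *+ size s)%:E <= nubar (\prod_(y <- s) ('X - y%:P)).[x])%E ->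
  exists2 y, y \in s & (eps%:E <= nubar (x - y)%R)%E.
Proof.
move=> s0 h; apply: contrapT => none.
have far y : y \in s -> (nubar (x - y)%R < eps%:E)%E.
  by move=> ys; rewrite ltNge; apply/negP => le; apply: none; exists y.
move: h; rewrite leNgt => /negP; apply.
elim: s s0 far {none} => //= y s IH _ far.
rewrite big_cons hornerM (valM nubarP) !hornerE.
have fy := far y (mem_head _ _).
case: s IH far => [|y' s] IH far.
  by rewrite big_nil hornerE (val1 nubarP) adde0.
rewrite mulrS EFinD; apply: lteD => //; apply: IH => // u us.
by apply: far; rewrite inE us orbT.
Qed.

Lemma prod_XsubC_diff (I : Type) (s : seq I) (z w : I -> Omega) (eps : R) :
  (forall i, (0 <= nubar (z i))%E) -> (forall i, (0 <= nubar (w i))%E) ->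
  (forall i, (eps%:E <= nubar (z i - w i)%R)%E) -> forall m,
  (eps%:E <= nubar (\prod_(i <- s) ('X - (w i)%:P) - \prod_(i <- s) ('X - (z i)%:P))`_m)%E.
Proof.
move=> z0 w0 zw; elim: s => [|i s IH] m.
  by rewrite !big_nil subrr coef0 (val0 nubarP) leey.
rewrite !big_cons; set p := \prod_(i <- s) ('X - (w i)%:P).
set q := \prod_(i <- s) ('X - (z i)%:P).
have -> : ('X - (w i)%:P) * p - ('X - (z i)%:P) * q =
    'X * (p - q) - (w i)%:P * (p - q) + (z i - w i)%:P * q.
  by rewrite polyCB; ring.
rewrite coefD coefB coefXM !coefCM; apply: (valD_ge nubarP).
  apply: (valB_ge nubarP).
    by case: eqP => _; [rewrite (val0 nubarP) leey | apply: IH].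
  by rewrite mulrC; apply: (valM0_ge nubarP).
by apply: (valM0_ge nubarP) => //; apply: (val_coef_prod_XsubC nubarP).
Qed.

Lemma csr_val_ge0 (p : {poly F}) : poly_over V p -> forall i, (0 <= nuhat p`_i)%E.
Proof. by move=> pV i; apply: (csr_ge0 csr). Qed.

Lemma csr0 : V 0.
Proof. by rewrite -[0](subrr 1); apply: (csrB csr); apply: (csr1 csr). Qed.

Lemma poly_over_const (a : F) : V a -> poly_over V a%:P.
Proof. by move=> Va i; rewrite coefC; case: eqP => _ //; apply: csr0. Qed.

Lemma dist_poly_val (P Q : {poly F}) : poly_over V P -> poly_over V Q -> Q != P ->
  exists delta : R, poly_val nuhat (Q - P) = delta%:E.
Proof.
move=> PV QV; rewrite -subr_eq0; set p := Q - P => pnz.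
case E : (poly_val nuhat p) => [r| |]; first by exists r.
  case/eqP: pnz; apply/polyP => i; rewrite coef0.
  apply: (val_eq_infty nuhatP) => a; move: i; apply/(poly_valP nuhatP).
  by rewrite E leey.
have : (0%:E <= poly_val nuhat p)%E.
  apply/(poly_valP nuhatP) => i; rewrite coefB.
  by apply: (valB_ge nuhatP); apply: csr_val_ge0.
by rewrite E.
Qed.

Section Roots.
Variables (d : nat) (z : 'I_d -> Omega) (P Q : {poly F}) (delta : R).
Hypotheses (PV : poly_over V P) (QV : poly_over V Q).
Hypotheses (Pmon : P \is monic) (Qmon : Q \is monic).
Hypothesis Qsize : size Q = size P.
Hypothesis Pz : map_poly emb P = \prod_(i < d) ('X - (z i)%:P).
Hypothesis dist : poly_val nuhat (Q - P) = delta%:E.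
Hypothesis d_gt0 : (0 < d)%N.
Let eps := delta / d%:R.
Hypothesis sep : forall i j, i != j -> (nubar (z i - z j)%R < eps%:E)%E.

Let eps_mul : eps *+ d = delta.
Proof. by rewrite -mulr_natr divfK // pnatr_eq0 -lt0n. Qed.

Lemma roots_ge0 i : (0 <= nubar (z i))%E.
Proof.
apply: (root_ge0 Pmon); first exact: csr_val_ge0.
rewrite Pz horner_prod; apply/eqP; rewrite prodf_seq_eq0; apply/hasP.
by exists i; rewrite ?mem_index_enum //= !hornerE subrr.
Qed.

Lemma size_roots : size P = d.+1.
Proof.
by rewrite -(size_map_poly emb) Pz size_prod_XsubC [index_enum _]unlock -enumT
  size_enum_ord.
Qed.

(** Q(z_i) = (Q - P)(z_i) has valuation at least delta, and is the product of
    the d differences of z_i with the roots of Q; so one of them has valuation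
    at least delta / d. Separation of the z_i makes the choice injective. *)
Lemma close_roots : exists2 w : 'I_d -> Omega,
  map_poly emb Q = \prod_(i < d) ('X - (w i)%:P) &
  forall i, (eps%:E <= nubar (z i - w i)%R)%E.
Proof.
have [rs] := closed_field_poly_normal (map_poly emb Q).
rewrite lead_coef_map (monicP Qmon) rmorph1 scale1r => Qrs.
have srs : size rs = d.
  by apply: succn_inj; rewrite -size_roots -Qsize -(size_map_poly emb) Qrs
    size_prod_XsubC.
have /choice[w hw] : forall i, exists y, y \in rs /\ (eps%:E <= nubar (z i - y)%R)%E.
  move=> i; have [||y yrs yz] := @prod_XsubC_close rs (z i) eps; rewrite ?srs //.
    rewrite -Qrs eps_mul.
    have -> : (map_poly emb Q).[z i] = (map_poly emb (Q - P)).[z i].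
      rewrite rmorphB hornerD hornerN (_ : (map_poly emb P).[z i] = 0) ?subr0 //.
      rewrite Pz horner_prod; apply/eqP; rewrite prodf_seq_eq0; apply/hasP.
      by exists i; rewrite ?mem_index_enum //= !hornerE subrr.
    apply: (val_horner_ge nubarP) (roots_ge0 i) => j.
    by rewrite coef_map nubar_ext; move: j; apply/(poly_valP nuhatP); rewrite dist.
  by exists y.
have winj : injective w.
  move=> i j wij; apply/eqP/negPn/negP => /sep; rewrite ltNge => /negP; apply.
  apply: (val_trans nubarP (hw i).2).
  by rewrite wij (valBC nubarP) (hw j).2.
exists w => [|i]; last exact: (hw i).2.
have u : uniq (codom w) by rewrite map_inj_uniq // enum_uniq.
have sub : {subset codom w <= rs} by move=> _ /codomP[i ->]; apply: (hw i).1.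
have sz : (size rs <= size (codom w))%N by rewrite srs size_codom card_ord.
have [_ eqi] := uniq_min_size u sub sz.
rewrite Qrs -(perm_big _ (uniq_perm u (leq_size_uniq u sub sz) eqi)) /=.
by rewrite big_map enumT [index_enum _]unlock.
Qed.

End Roots.
End RootMatching.

(** * Transfer of the factorization *)

Section FactorTransfer.
Context {R : realType} {F : fieldType} {nuhat : F -> \bar R}.
Context {Omega : closedFieldType} {emb : {rmorphism F -> Omega}}.
Context {nubar : Omega -> \bar R}.
Hypotheses (nuhatP : valuation nuhat) (nubarP : valuation nubar).
Hypothesis nubar_ext : extends_val emb nuhat nubar.
Hypothesis complete : forall u : nat -> F, val_cauchy nuhat u ->
  exists l, val_cvg nuhat u l.
Hypothesis emb_alg : forall x, algebraicOver emb x.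
Hypothesis char0 : [pchar F] =i pred0.
Context {V : set F}.
Hypothesis csr : closed_subring nuhat V.

(** Monic factors of a polynomial with distinct roots correspond to sets of
    roots: if each root is given to a factor it annihilates, the linear
    polynomials so obtained have the right product, so that none is missing. *)
Lemma factor_roots (d r : nat) (z : 'I_d -> Omega) (p : 'I_r -> {poly Omega}) :
  injective z -> (forall l, p l \is monic) ->
  \prod_(l < r) p l = \prod_(i < d) ('X - (z i)%:P) ->
  exists c : 'I_d -> 'I_r, forall l,
    p l = \prod_(i <- [seq i <- index_enum 'I_d | c i == l]) ('X - (z i)%:P).
Proof.
move=> zinj pmon pE.
have /choice[c hc] : forall i, exists l, root (p l) (z i).
  move=> i; have : root (\prod_(l < r) p l) (z i).
    rewrite pE /root horner_prod prodf_seq_eq0; apply/hasP.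
    by exists i; rewrite ?mem_index_enum //= !hornerE subrr.
  rewrite /root horner_prod prodf_seq_eq0 => /hasP[l _ /= hl].
  by exists l.
exists c => l; pose q l := \prod_(i <- [seq i <- index_enum 'I_d | c i == l]) ('X - (z i)%:P).
have qmon l' : q l' \is monic by apply: monic_prod_XsubC.
have qp l' : q l' %| p l'.
  rewrite /q -(big_map z xpredT (fun x => 'X - x%:P)); apply: uniq_roots_dvdp.
    by apply/allP => y /mapP[i]; rewrite mem_filter => /andP[/eqP <- _] ->; apply: hc.
  by rewrite uniq_rootsE map_inj_uniq // filter_uniq // index_enum_uniq.
have /choice[g hg] : forall l', exists g, p l' = g * q l'.
  by move=> l'; apply/dvdpP.
have qE : \prod_(l' < r) q l' = \prod_(i < d) ('X - (z i)%:P).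
  rewrite [RHS](partition_big c xpredT) //=.
  by apply: eq_bigr => l' _; rewrite /q big_filter.
have g1 : \prod_(l' < r) g l' = 1.
  have : \prod_(l' < r) p l' = \prod_(l' < r) g l' * \prod_(l' < r) q l'.
    by rewrite -big_split; apply: eq_bigr => l' _ /=.
  rewrite pE -qE -{1}[\prod_(l' < r) q l']mul1r => /esym/mulIf; apply.
  by apply: monic_neq0; apply: monic_prod.
apply/eqP; rewrite -(eqp_monic (pmon l) (qmon l)) eqp_sym /eqp qp /= hg -{2}[q l]mul1r.
rewrite dvdp_mul2r ?monic_neq0 // -g1 (bigD1 l) //=.
exact: dvdp_mulr.
Qed.

Section Irreducibility.
Variables (d : nat) (z w : 'I_d -> Omega) (P Q : {poly F}) (eps : R).
Hypotheses (QV : poly_over V Q) (Qmon : Q \is monic).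
Hypotheses (PV : poly_over V P) (Pmon : P \is monic).
Hypothesis Pz : map_poly emb P = \prod_(i < d) ('X - (z i)%:P).
Hypothesis Qw : map_poly emb Q = \prod_(i < d) ('X - (w i)%:P).
Hypothesis close : forall i, (eps%:E <= nubar (z i - w i)%R)%E.
Hypothesis sep : forall i j, i != j -> (nubar (z i - z j)%R < eps%:E)%E.

Let close' i : (eps%:E <= nubar (w i - z i)%R)%E.
Proof. by rewrite (valBC nubarP). Qed.

Let sep' i j : i != j -> (nubar (w i - w j)%R < eps%:E)%E.
Proof.
move=> ij; rewrite ltNge; apply/negP => le; have := sep ij; rewrite ltNge => /negP; apply.
apply: (val_trans nubarP (close i)); apply: (val_trans nubarP le); exact: close'.
Qed.

Lemma subproduct_over (U : 'I_d -> Omega) (S : {poly F}) (s : seq 'I_d) q :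
  S \is monic -> poly_over V S -> map_poly emb S = \prod_(i < d) ('X - (U i)%:P) ->
  map_poly emb q = \prod_(i <- s) ('X - (U i)%:P) -> poly_over V q.
Proof.
move=> Smon SV SU qU m.
have [p [pmon pV pq]] := coef_factor_integral (csr1 csr) (csrB csr) (csrM csr)
  Smon SV SU qU (fun i _ => mem_index_enum i) m.
apply: (csr_alg csr (monic_neq0 pmon) pV pq).
rewrite -nubar_ext -coef_map qU; apply: (val_coef_prod_XsubC nubarP) => i.
exact: (roots_ge0 nubarP nubar_ext csr SV Smon SU).
Qed.

Lemma monic_subproduct (U : 'I_d -> Omega) (s : seq 'I_d) (q q1 q2 : {poly F}) :
  uniq s -> map_poly emb q = \prod_(i <- s) ('X - (U i)%:P) ->
  q = q1 * q2 -> q1 \is monic ->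
  exists t, [/\ uniq t, perm_eq s (t ++ [seq i <- s | i \notin t]) &
    map_poly emb q1 = \prod_(i <- t) ('X - (U i)%:P)].
Proof.
move=> us qU q12 q1mon.
have : map_poly emb q1 %| \prod_(i <- s) ('X - (U i)%:P).
  by rewrite -qU dvdp_map q12 dvdp_mulr.
move=> /dvdp_prod_XsubC[m]; rewrite eqp_monic ?map_monic ?monic_prod_XsubC //.
move=> /eqP q1E; have ut : uniq (mask m s) by apply: mask_uniq.
exists (mask m s); split=> //; apply: uniq_perm => //.
  rewrite cat_uniq ut filter_uniq // andbT; apply/hasPn => i.
  by rewrite mem_filter => /andP[].
move=> i; rewrite mem_cat mem_filter; case: (boolP (i \in mask m s)) => //=.
by move=> /mem_mask.
Qed.

(** The hypotheses are symmetric in z and w. So the two factors of a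
    factorization of q over V, once made monic, transfer back to polynomials
    over V with product p. *)
Lemma irreducible_transfer (s : seq 'I_d) p q : uniq s ->
  map_poly emb p = \prod_(i <- s) ('X - (z i)%:P) ->
  map_poly emb q = \prod_(i <- s) ('X - (w i)%:P) ->
  irreducible_over V p -> irreducible_over V q.
Proof.
move=> us pz qw [pV pnz pnu pirr].
have qV : poly_over V q by apply: subproduct_over Qw qw.
have qmon : q \is monic by rewrite -(map_monic emb) qw monic_prod_XsubC.
split=> //; first exact: monic_neq0.
  move=> /poly_unit_size; rewrite -(size_map_poly emb) qw size_prod_XsubC.
  case: (s) pz => // pz _; apply: pnu.
  have -> : p = 1 by apply: (map_poly_inj emb); rewrite pz big_nil rmorph1.
  by exists 1; rewrite ?mulr1 //; apply: (poly_over_const csr (csr1 csr)).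
move=> q1 q2 q1V q2V q12.
pose a := lead_coef q1; pose b := lead_coef q2.
have ab : a * b = 1 by rewrite -lead_coefM -q12 (monicP qmon).
have aV : V a by apply: q1V.
have bV : V b by apply: q2V.
have bq1mon : b *: q1 \is monic by rewrite monicE lead_coefZ mulrC ab.
have aq2mon : a *: q2 \is monic by rewrite monicE lead_coefZ ab.
have qE : q = (b *: q1) * (a *: q2).
  by rewrite -scalerAl -scalerAr scalerA [b * a]mulrC ab scale1r.
have [t1 [ut1 perm q1w]] := monic_subproduct us qw qE bq1mon.
set t2 := [seq _ <- _ | _] in perm.
have ut2 : uniq t2 by rewrite filter_uniq.
have q2w : map_poly emb (a *: q2) = \prod_(i <- t2) ('X - (w i)%:P).
  have := qw; rewrite (perm_big _ perm) big_cat /= -q1w qE rmorphM /=.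
  by apply: mulfI; rewrite map_poly_eq0 monic_neq0.
have tr t g : uniq t -> map_poly emb g = \prod_(i <- t) ('X - (w i)%:P) ->
    exists2 h, poly_over V h & map_poly emb h = \prod_(i <- t) ('X - (z i)%:P).
  move=> ut gw.
  have [h hz] := krasner_transfer nuhatP nubarP nubar_ext complete emb_alg char0
    Qw Pz close' sep' ut gw.
  by exists h => //; apply: subproduct_over Pz hz.
have [p1 p1V p1z] := tr _ _ ut1 q1w; have [p2 p2V p2z] := tr _ _ ut2 q2w.
have p12 : p = p1 * p2.
  by apply: (map_poly_inj emb); rewrite rmorphM /= p1z p2z -big_cat -(perm_big _ perm).
have unit_of t (h g : {poly F}) c e : c * e = 1 -> V c ->
    map_poly emb h = \prod_(i <- t) ('X - (z i)%:P) ->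
    map_poly emb (c *: g) = \prod_(i <- t) ('X - (w i)%:P) ->
    Defs.poly_unit V h -> Defs.poly_unit V g.
  move=> ce cV hz gw /poly_unit_size.
  rewrite -(size_map_poly emb) hz size_prod_XsubC => -[/size0nil t0].
  exists c%:P; first exact: (poly_over_const csr).
  rewrite mulrC mul_polyC; apply: (map_poly_inj emb).
  by rewrite gw t0 big_nil rmorph1.
have ba : b * a = 1 by rewrite mulrC.
case: (pirr _ _ p1V p2V p12) => [h1|h2]; [left|right].
  exact: unit_of ba bV p1z q1w h1.
exact: unit_of ab aV p2z q2w h2.
Qed.

End Irreducibility.

Lemma close_polynomial_factors (d : nat) (P Q : {poly F}) (r : nat)
    (Pi : 'I_r -> {poly F}) (z : 'I_d -> Omega) :
  poly_over V P -> P \is monic -> poly_over V Q -> Q \is monic ->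
  size P = d.+1 -> size Q = size P ->
  (forall i, [/\ poly_over V (Pi i), Pi i \is monic & irreducible_over V (Pi i)]) ->
  P = \prod_(i < r) Pi i ->
  map_poly emb P = \prod_(i < d) ('X - (z i)%:P) ->
  (d%:R%:E * \big[Order.max/-oo]_(ij : 'I_d * 'I_d | ij.1 != ij.2)
          nubar (z ij.1 - z ij.2)%R < poly_val nuhat (Q - P)%R)%E ->
  exists Qi : 'I_r -> {poly F},
    [/\ forall i, [/\ poly_over V (Qi i), Qi i \is monic & irreducible_over V (Qi i)],
        Q = \prod_(i < r) Qi i &
        forall i, ((d%:R^-1)%:E * poly_val nuhat (Q - P)%R <=
                   poly_val nuhat (Qi i - Pi i)%R)%E].
Proof.
move=> PV Pmon QV Qmon sP sQ Pi_irr PE Pz Qclose.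
have [->|QP] := eqVneq Q P.
  exists Pi; split=> // i.
  by rewrite !subrr /poly_val size_poly0 [X in (_ <= X)%E]big_ord0 leey.
have d0 : (0 < d)%N.
  rewrite lt0n; apply/negP => /eqP d0; case/eqP: QP.
  have sP1 : size P = 1%N by rewrite sP d0.
  by rewrite (monic_size1 Qmon (etrans sQ sP1)) (monic_size1 Pmon sP1).
have [delta dE] := dist_poly_val nuhatP csr PV QV QP.
pose eps := delta / d%:R.
(* In particular the z_i are distinct, as nubar 0 is infinite. *)
have sep i j : i != j -> (nubar (z i - z j)%R < eps%:E)%E.
  move=> ij; rewrite ltNge; apply/negP => le; move: Qclose.
  rewrite dE ltNge => /negP; apply.
  have -> : delta%:E = (d%:R%:E * eps%:E)%E.
    by rewrite -EFinM mulrC divfK // pnatr_eq0 -lt0n.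
  apply: lee_wpmul2l; first by rewrite lee_fin ler0n.
  apply: le_trans le _.
  exact: (le_bigmax_cond _ (fun ij : 'I_d * 'I_d => nubar (z ij.1 - z ij.2))
    (j := (i, j))).
have [w Qw close] :=
  close_roots nuhatP nubarP nubar_ext csr PV Pmon Qmon sQ Pz dE d0 sep.
have Pimon l : Pi l \is monic by have [] := Pi_irr l.
have [||| c Pic] := @factor_roots d r z (fun l => map_poly emb (Pi l)).
- by move=> i j; apply: (separated_inj nubarP sep).
- by move=> l; rewrite map_monic.
- by rewrite -rmorph_prod -PE.
have /choice[Qi Qiw] : forall l, exists q, map_poly emb q =
    \prod_(i <- [seq i <- index_enum 'I_d | c i == l]) ('X - (w i)%:P).
  move=> l; apply: (krasner_transfer nuhatP nubarP nubar_ext complete emb_alg char0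
    Pz Qw close sep _ (Pic l)).
  by rewrite filter_uniq // index_enum_uniq.
exists Qi; split.
- move=> l; split.
  + exact: subproduct_over Qmon QV Qw (Qiw l).
  + by rewrite -(map_monic emb) Qiw monic_prod_XsubC.
  + have [_ _ irr] := Pi_irr l.
    apply: (irreducible_transfer QV Qmon PV Pmon Pz Qw close sep _ (Pic l) (Qiw l) irr).
    by rewrite filter_uniq // index_enum_uniq.
- apply: (map_poly_inj emb); rewrite Qw rmorph_prod /=.
  rewrite [LHS](partition_big c xpredT) //=.
  by apply: eq_bigr => l _; rewrite Qiw big_filter.
- move=> l; rewrite dE -EFinM mulrC -/eps; apply/(poly_valP nuhatP) => m.
  rewrite -nubar_ext -coef_map rmorphB /= Qiw Pic.
  apply: (prod_XsubC_diff nubarP) => // i.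
    exact: (roots_ge0 nubarP nubar_ext csr PV Pmon Pz).
  exact: (roots_ge0 nubarP nubar_ext csr QV Qmon Qw).
Qed.

End FactorTransfer.

(** * Finitely generated semigroups of nonnegative reals *)

Section Semigroups.
Context {R : realType}.
Implicit Types (l t : seq R) (e x y : R).

Definition sgen l : set R :=
  [set x | exists2 t, {subset t <= l} & x = \sum_(y <- t) y].

Lemma sgen0 l : sgen l 0.
Proof. by exists [::]; rewrite ?big_nil. Qed.

Lemma sgenD l x y : sgen l x -> sgen l y -> sgen l (x + y).
Proof.
move=> [t tl ->] [t' tl' ->]; exists (t ++ t'); rewrite ?big_cat //.
by move=> z; rewrite mem_cat => /orP[/tl|/tl'].
Qed.

Lemma sgen_gen l x : x \in l -> sgen l x.
Proof. by move=> xl; exists [:: x]; rewrite ?big_seq1 // => y; rewrite inE => /eqP ->. Qed.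

Lemma sgen_sub l l' : {subset l <= l'} -> sgen l `<=` sgen l'.
Proof. by move=> s x [t tl ->]; exists t => // y /tl/s. Qed.

Lemma sgen_ge0 l : (forall g, g \in l -> 0 <= g) -> forall x, sgen l x -> 0 <= x.
Proof. by move=> l0 x [t tl ->]; rewrite big_seq; apply: sumr_ge0 => y /tl/l0. Qed.

Lemma sgen_cons g l x : sgen (g :: l) x ->
  exists c y, sgen l y /\ x = g *+ c + y.
Proof.
move=> [t tl ->]; exists (count_mem g t), (\sum_(y <- t | y != g) y); split.
  exists [seq y <- t | y != g]; last by rewrite big_filter.
  move=> y; rewrite mem_filter => /andP[yg /tl].
  by rewrite inE (negbTE yg).
rewrite (bigID (pred1 g)) /=; congr (_ + _).
rewrite (eq_bigr (fun=> g)); last by move=> y /eqP.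
by rewrite big_const_seq iter_addr_0.
Qed.

Lemma sgen_finite l x : (forall g, g \in l -> 0 <= g) ->
  finite_set (sgen l `&` [set y | y < x]).
Proof.
elim: l => [|g l IH] l0.
  apply: (@sub_finite_set _ _ [set 0]); last exact: finite_set1.
  move=> _ [[t tl ->] _] /=; rewrite big_seq big1 // => y /tl.
  by rewrite in_nil.
have lge0 h : h \in l -> 0 <= h by move=> hl; apply: l0; rewrite inE hl orbT.
have {}IH := IH lge0.
have : 0 <= g by apply: l0; rewrite inE eqxx.
rewrite le_eqVlt => /orP[/eqP g0|g0].
  apply: sub_finite_set IH => y [/sgen_cons[c [z [zl ->]]] /=].
  by rewrite -g0 mul0rn add0r.
pose N := (Num.trunc (x / g)).+1.
apply: (@sub_finite_set _ _ ((fun p : nat * R => g *+ p.1 + p.2) @`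
    (`I_N `*` (sgen l `&` [set y | y < x])))); last first.
  by apply: finite_image; apply: finite_setX => //; apply: finite_II.
move=> y [/sgen_cons[c [z [zl ->]]] /= lt]; have z0 := sgen_ge0 lge0 zl.
have gc0 : 0 <= g *+ c by rewrite mulrn_wge0 // ltW.
exists (c, z) => //=; split; last by split=> //=; lra.
have cx : c%:R < x / g by rewrite ltr_pdivlMr // mulr_natl; lra.
by rewrite -(@ltr_nat R) (lt_trans cx) // truncnS_gt.
Qed.

(** Finite generation survives a shift by e: an element of the semigroup is
    built by adding generators one at a time, and it passes e within a
    bounded window, which contains finitely many elements. *)
Lemma sgen_shift l e : (forall g, g \in l -> 0 <= g) ->
  exists2 l', (forall g, g \in l' -> 0 <= g) &
    forall x, sgen l x -> e <= x -> sgen l' (x - e).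
Proof.
move=> l0.
pose G := 1 + `|e| + \sum_(g <- l) g.
have lG g : g \in l -> g <= G - 1 - `|e|.
  move=> gl; rewrite /G (big_rem g) //=.
  have : 0 <= \sum_(y <- rem g l) y by rewrite big_seq sumr_ge0 // => y /mem_rem/l0.
  by lra.
have G0 : 0 < e + G.
  have : 0 <= \sum_(g <- l) g by rewrite big_seq sumr_ge0.
  by have := ler_norm (- e); rewrite normrN /G; lra.
have /finite_seqP[W hW] := sgen_finite (e + G) l0.
have inW x : sgen l x -> x < e + G -> x \in W.
  by move=> xl xG; have : [set` W] x by rewrite -hW.
pose l' := l ++ [seq y - e | y <- W & e <= y].
have W' x : sgen l x -> x < e + G -> e <= x -> sgen l' (x - e).
  move=> xl xG ex; apply: sgen_gen; rewrite mem_cat; apply/orP; right.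
  by apply: map_f; rewrite mem_filter ex inW.
exists l' => [g|_ [t tl ->]].
  rewrite mem_cat => /orP[/l0 //|/mapP[y]].
  by rewrite mem_filter => /andP[ey _] ->; rewrite subr_ge0.
elim: t tl => [|g t IH] tl.
  by rewrite big_nil => e0; apply: W' => //; apply: sgen0.
have gl : g \in l by apply: tl; rewrite inE eqxx.
have tl' : {subset t <= l} by move=> y yt; apply: tl; rewrite inE yt orbT.
have [le|lt] := leP e (\sum_(y <- t) y).
  move=> _; rewrite big_cons -addrA; apply: sgenD; last exact: IH.
  by apply: sgen_gen; rewrite mem_cat gl.
move=> le; apply: W' => //; first by exists (g :: t).
by rewrite big_cons; have := lG g gl; have := normr_ge0 e; lra.
Qed.

Lemma semigroup_gen_sgen s (g : 'I_s -> R) : semigroup_gen g `<=` sgen (codom g).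
Proof.
move=> _ [c ->]; elim/big_ind: _ => [||j _]; [exact: sgen0 | exact: sgenD |].
elim: (c j) => [|n IH]; first by rewrite mulr0n; apply: sgen0.
by rewrite mulrS; apply: sgenD => //; apply: sgen_gen; apply: codom_f.
Qed.

Lemma sgen_semigroup_gen l :
  sgen l `<=` semigroup_gen (fun j : 'I_(size l) => l`_j).
Proof.
move=> _ [t tl ->]; rewrite big_seq; elim/big_ind: _ => [|x y|g /tl gl].
- by exists (fun=> 0%N); rewrite big1 // => j _; rewrite mulr0n.
- move=> [c ->] [c' ->]; exists (fun j => c j + c' j)%N.
  by rewrite -big_split; apply: eq_bigr => j _; rewrite mulrnDr.
have lt : (index g l < size l)%N by rewrite index_mem.
exists (fun j => (j == Ordinal lt) : nat).
rewrite (bigD1 (Ordinal lt)) //= eqxx mulr1n nth_index // big1 ?addr0 // => j.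
by move=> /negbTE ->; rewrite mulr0n.
Qed.

Lemma sgen_discrete l : (forall g, g \in l -> 0 <= g) ->
  forall A : set R, A `<=` sgen l -> limit_point A = set0.
Proof.
move=> l0 A Al; apply/seteqP; split=> // a /limit_point_infinite_setP.
move=> /(_ [set y | y < a + 1]) inf; apply: inf.
  by apply: open_nbhs_nbhs; split; [apply: open_lt | rewrite /= ltrDl].
apply: sub_finite_set (sgen_finite (a + 1) l0).
by move=> y [/= ya /Al].
Qed.

End Semigroups.

(** * Graded systems of terms *)

(** Nonzero elements of T i are the possible terms of degree i of an
    expansion. *)
Record term_system (R : realType) (K : fieldType) (v : K -> \bar R)
    (T : R -> set K) : Prop := TermSystem {
  ts_val : forall i t, T i t -> t != 0 -> v t = i%:E;
  ts1 : T 0 1;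
  tsD : forall i s t, T i s -> T i t -> s + t != 0 -> T i (s + t);
  tsN : forall i t, T i t -> T i (- t);
  tsM : forall i j s t, T i s -> T j t -> T (i + j) (s * t);
  tsV : forall i t, T i t -> t != 0 -> T (- i) t^-1 }.

Section TermSystems.
Context {R : realType} {K : fieldType} {v : K -> \bar R} {T : R -> set K}.
Hypotheses (vP : valuation v) (tsP : term_system v T).
Implicit Types (S : set R) (x y t : K) (a e i : R) (w : R -> K).

Definition fsum S x := exists2 l : seq (R * K),
  (forall p, p \in l -> S p.1 /\ T p.1 p.2) & x = \sum_(p <- l) p.2.

Lemma fsum0 S : fsum S 0.
Proof. by exists [::]; rewrite ?big_nil. Qed.

Lemma fsumD S x y : fsum S x -> fsum S y -> fsum S (x + y).
Proof.
move=> [l hl ->] [l' hl' ->]; exists (l ++ l'); rewrite ?big_cat //.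
by move=> p; rewrite mem_cat => /orP[/hl|/hl'].
Qed.

Lemma fsum_term S i t : S i -> T i t -> fsum S t.
Proof. by move=> Si Tt; exists [:: (i, t)]; rewrite ?big_seq1 // => p; rewrite inE => /eqP ->. Qed.

Lemma fsum_sum S (I : eqType) (s : seq I) (f : I -> K) :
  (forall j, j \in s -> fsum S (f j)) -> fsum S (\sum_(j <- s) f j).
Proof.
by move=> h; rewrite big_seq; elim/big_ind: _ => //; [apply: fsum0 | apply: fsumD].
Qed.

Lemma fsumN S x : fsum S x -> fsum S (- x).
Proof.
move=> [l hl ->]; rewrite -sumrN; apply: fsum_sum => p /hl[Sp Tp].
exact: fsum_term Sp (tsN tsP Tp).
Qed.

Lemma fsumM S x y : (forall i j, S i -> S j -> S (i + j)) ->
  fsum S x -> fsum S y -> fsum S (x * y).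
Proof.
move=> SD [l hl ->] [l' hl' ->]; rewrite mulr_suml; apply: fsum_sum => p /hl[Sp Tp].
rewrite mulr_sumr; apply: fsum_sum => q /hl'[Sq Tq].
exact: fsum_term (SD _ _ Sp Sq) (tsM tsP Tp Tq).
Qed.

Lemma fsum_mono S S' x : S `<=` S' -> fsum S x -> fsum S' x.
Proof. by move=> SS' [l hl ->]; exists l => // p /hl[/SS']. Qed.

Lemma fsum_ge S a x : (forall i, S i -> a <= i) -> fsum S x -> (a%:E <= v x)%E.
Proof.
move=> Sa [l hl ->]; rewrite big_seq; apply: (val_sum_ge vP) => p /hl[Sp Tp].
have [->|t0] := eqVneq p.2 0; first by rewrite (val0 vP) leey.
by rewrite (ts_val tsP Tp t0) lee_fin Sa.
Qed.

(** Normal form of a finite sum of terms: w i is its only term of degree i. *)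
Definition graded w (s : seq R) :=
  uniq s /\ forall i, w i != 0 -> i \in s /\ T i (w i).

Lemma graded_wide w s s' : graded w s -> uniq s' -> {subset s <= s'} ->
  \sum_(i <- s) w i = \sum_(i <- s') w i.
Proof.
move=> [us hs] us' ss'.
have nz r : \sum_(i <- r) w i = \sum_(i <- [seq i <- r | w i != 0]) w i.
  rewrite (bigID (fun i => w i != 0)) /= addrC big1 ?add0r ?big_filter //.
  by move=> i /negPn/eqP.
rewrite (nz s) (nz s'); apply: perm_big.
apply: uniq_perm; rewrite ?filter_uniq // => i; rewrite !mem_filter.
case: (boolP (w i == 0)) => //= /hs[is_ _]; rewrite is_.
exact/esym/ss'.
Qed.

Lemma fsum_graded S x : fsum S x -> exists w s, [/\ graded w s,
  x = \sum_(i <- s) w i & forall i, w i != 0 -> S i].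
Proof.
move=> [l hl ->]; pose w i := \sum_(p <- l | p.1 == i) p.2.
have wT i : w i != 0 -> T i (w i).
  rewrite /w big_seq_cond; elim/big_ind: _ => [|y z IHy IHz|p].
  - by rewrite eqxx.
  - have [->|y0] := eqVneq y 0; first by rewrite add0r.
    have [->|z0] := eqVneq z 0; first by rewrite addr0.
    by apply: (tsD tsP); [apply: IHy | apply: IHz].
  - by move=> /andP[/hl[_ Tp] /eqP <-].
have win i : w i != 0 -> exists2 p, p \in l & p.1 = i.
  move=> wi; apply: contrapT => none; case/eqP: wi.
  rewrite /w big_seq_cond big1 // => p /andP[pl /eqP pi].
  by case: none; exists p.
exists w, (undup (map fst l)); split.
- split=> [|i wi]; first exact: undup_uniq.
  split; last exact: wT.
  by have [p pl <-] := win i wi; rewrite mem_undup map_f.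
- rewrite (exchange_big_dep xpredT) //= big_seq [RHS]big_seq; apply: eq_bigr => p pl.
  under eq_bigl => i do rewrite eq_sym.
  by rewrite -big_filter filter_pred1_uniq ?big_seq1 ?undup_uniq // mem_undup map_f.
- by move=> i /win[p /hl[Sp _] <-].
Qed.

Lemma graded_fsum S w s : graded w s ->
  (forall i, w i != 0 -> S i) -> fsum S (\sum_(i <- s) w i).
Proof.
move=> [us hs] wS; apply: fsum_sum => i _.
have [->|wi] := eqVneq (w i) 0; first exact: fsum0.
exact: fsum_term (wS i wi) (hs i wi).2.
Qed.

Lemma seq_min (s : seq R) : s != [::] ->
  exists2 i, i \in s & forall j, j \in s -> i <= j.
Proof.
elim: s => // i s IH _; have [-> |s0] := eqVneq s [::].
  by exists i; rewrite ?inE // => j; rewrite inE => /eqP ->.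
have [j js jmin] := IH s0; have [le|lt] := leP i j.
  exists i; rewrite ?mem_head // => h; rewrite inE => /orP[/eqP -> //|/jmin].
  exact: le_trans.
exists j; rewrite ?inE ?js ?orbT // => h; rewrite inE => /orP[/eqP ->|/jmin //].
exact: ltW.
Qed.

Lemma graded_tail_gt w s a : graded w s ->
  (forall i, i < a -> w i = 0) ->
  (a%:E < v (\sum_(i <- s) w i - w a)%R)%E.
Proof.
move=> [us hs] low.
have -> : \sum_(i <- s) w i - w a = \sum_(i <- s | i != a) w i.
  have [as_|as_] := boolP (a \in s).
    by rewrite (bigD1_seq a) //= addrAC subrr add0r.
  have -> : w a = 0 by apply/eqP/negPn/negP => /hs[]; rewrite (negbTE as_).
  rewrite subr0 [RHS]big_mkcond big_seq [RHS]big_seq; apply: eq_bigr => i is_.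
  by case: eqP => // ia; rewrite -ia is_ in as_.
elim/big_ind: _ => [|x y|i ia]; first by rewrite (val0 vP) ltry.
  exact: valD_gt vP _ _ _.
have [->|wi] := eqVneq (w i) 0; first by rewrite (val0 vP) ltry.
rewrite (ts_val tsP (hs i wi).2 wi) lte_fin lt_neqAle eq_sym ia /=.
by rewrite leNgt; apply/negP => /low /eqP; apply/negP.
Qed.

(** Terms of distinct degrees cannot cancel. *)
Lemma graded_low w s a : graded w s ->
  (a%:E <= v (\sum_(i <- s) w i)%R)%E -> forall i, i < a -> w i = 0.
Proof.
move=> gw av i ia; apply/eqP/negPn/negP => wi; have [us hs] := gw.
pose s0 := [seq j <- s | w j != 0].
have [|j js0 jmin] := @seq_min s0.
  have : i \in s0 by rewrite mem_filter wi (hs i wi).1.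
  by case: s0.
move: js0; rewrite mem_filter => /andP[wj js].
have low h : h < j -> w h = 0.
  move=> hj; apply/eqP/negPn/negP => wh; have [hin _] := hs h wh.
  have : h \in s0 by rewrite mem_filter wh.
  by move/jmin; rewrite leNgt hj.
have vj := ts_val tsP (hs j wj).2 wj.
have := val_dominant vP vj (graded_tail_gt gw low) => vs.
move: av; rewrite vs lee_fin leNgt => /negP; apply; apply: le_lt_trans ia.
by apply: jmin; rewrite mem_filter wi (hs i wi).1.
Qed.

Lemma graded_unique w s w' s' a : graded w s -> graded w' s' ->
  (a%:E <= v (\sum_(i <- s) w i - \sum_(i <- s') w' i)%R)%E ->
  forall i, i < a -> w i = w' i.
Proof.
move=> gw gw' av i ia; pose r := undup (s ++ s').
have ur : uniq r by apply: undup_uniq.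
have sr : {subset s <= r} by move=> j js; rewrite mem_undup mem_cat js.
have sr' : {subset s' <= r} by move=> j js; rewrite mem_undup mem_cat js orbT.
move: av; rewrite (graded_wide gw ur sr) (graded_wide gw' ur sr') -sumrB => av.
apply/eqP; rewrite -subr_eq0; apply/eqP.
apply: (@graded_low (fun j => w j - w' j) r a) ia => //; split=> // j.
have [wj|wj] := eqVneq (w j) 0; have [wj'|wj'] := eqVneq (w' j) 0.
- by rewrite wj wj' subrr eqxx.
- move=> _; split; first by apply: sr'; apply: (gw'.2 j wj').1.
  by rewrite wj sub0r; apply: (tsN tsP); apply: (gw'.2 j wj').2.
- move=> _; split; first by apply: sr; apply: (gw.2 j wj).1.
  by rewrite wj' subr0; apply: (gw.2 j wj).2.
move=> ne; split; first by apply: sr; apply: (gw.2 j wj).1.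
by apply: (tsD tsP) ne; [apply: (gw.2 j wj).2 | apply: (tsN tsP); apply: (gw'.2 j wj').2].
Qed.

(** The expansions with support in S, seen as limits of finite sums, so that
    the ring operations extend to them by continuity. *)
Definition cl S x := forall a, exists2 y, fsum S y & (a%:E <= v (x - y)%R)%E.

Lemma cl_fsum S x : fsum S x -> cl S x.
Proof. by move=> Sx a; exists x; rewrite // subrr (val0 vP) leey. Qed.

Lemma cl_mono S S' x : S `<=` S' -> cl S x -> cl S' x.
Proof. by move=> SS' Sx a; have [y Sy ay] := Sx a; exists y => //; apply: fsum_mono Sy. Qed.

Lemma clB S x y : cl S x -> cl S y -> cl S (x - y).
Proof.
move=> Sx Sy a; have [x' Sx' ax] := Sx a; have [y' Sy' ay] := Sy a.
exists (x' - y'); first by apply: fsumD => //; apply: fsumN.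
have -> : x - y - (x' - y') = (x - x') - (y - y') by ring.
exact: valB_ge.
Qed.

Lemma cl0 S : cl S 0. Proof. exact/cl_fsum/fsum0. Qed.

Lemma clN S x : cl S x -> cl S (- x).
Proof. by rewrite -sub0r; apply: clB; apply: cl0. Qed.

Lemma clD S x y : cl S x -> cl S y -> cl S (x + y).
Proof. by move=> Sx Sy; rewrite -[y]opprK; apply: clB => //; apply: clN. Qed.

Lemma clM S x y : (forall i j, S i -> S j -> S (i + j)) ->
  cl S x -> cl S y -> cl S (x * y).
Proof.
move=> SD Sx Sy a.
have [c c0 hc] := val_seq_bounded vP [:: x; y].
have cx : (c%:E <= v x)%E by apply: hc; rewrite !inE eqxx.
have cy : (c%:E <= v y)%E by apply: hc; rewrite !inE eqxx orbT.
pose b := Num.max (a - c) c.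
have [x' Sx' ax] := Sx b; have [y' Sy' ay] := Sy b.
have ba : ((a - c)%:E <= b%:E)%E by rewrite lee_fin le_max lexx.
have bc : (c%:E <= b%:E)%E by rewrite lee_fin le_max lexx orbT.
exists (x' * y'); first exact: fsumM.
have cx' : (c%:E <= v x')%E.
  have -> : x' = x - (x - x') by ring.
  by apply: (valB_ge vP) => //; apply: le_trans ax.
have -> : x * y - x' * y' = (x - x') * y + (y - y') * x' by ring.
rewrite -[a](subrK c); apply: (valD_ge vP).
  by apply: (valM_ge vP) => //; apply: le_trans ax.
by apply: (valM_ge vP) => //; apply: le_trans ay.
Qed.

Lemma cl1 S : S 0 -> cl S 1.
Proof. by move=> S0; apply/cl_fsum/(fsum_term S0)/(ts1 tsP). Qed.

Lemma clX S x n : S 0 -> (forall i j, S i -> S j -> S (i + j)) -> cl S x -> cl S (x ^+ n).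
Proof.
move=> S0 SD Sx; elim: n => [|n IH]; first exact: cl1.
by rewrite exprS; apply: clM.
Qed.

Lemma cl_sum S (I : Type) (s : seq I) (P : pred I) (f : I -> K) :
  (forall j, P j -> cl S (f j)) -> cl S (\sum_(j <- s | P j) f j).
Proof. by move=> h; elim/big_ind: _ => //; [apply: cl0 | apply: clD]. Qed.

Lemma clMn S x n : cl S x -> cl S (x *+ n).
Proof.
move=> Sx; elim: n => [|n IH]; first by rewrite mulr0n; apply: cl0.
by rewrite mulrS; apply: clD.
Qed.

Lemma cl_limit S x : (forall a, exists2 y, cl S y & (a%:E <= v (x - y)%R)%E) -> cl S x.
Proof.
move=> h a; have [y Sy ay] := h a; have [y' Sy' ay'] := Sy a.
by exists y' => //; apply: (val_trans vP ay).
Qed.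

Lemma cl_ge0 S x : (forall i, S i -> 0 <= i) -> cl S x -> (0 <= v x)%E.
Proof.
move=> S0 Sx; have [y Sy ay] := Sx 0; rewrite -[x](subrK y).
by apply: (valD_ge vP) => //; apply: fsum_ge Sy.
Qed.

Lemma cl_horner S (p : {poly K}) x : S 0 -> (forall i j, S i -> S j -> S (i + j)) ->
  (forall k, cl S p`_k) -> cl S x -> cl S p.[x].
Proof.
move=> S0 SD Sp Sx; rewrite horner_coef; apply: cl_sum => i _.
by apply: clM => //; apply: clX.
Qed.

(** Since f has valuation at least e, its approximations involve only terms of
    degree at least e, so that the degrees left after division are in the
    shifted support S'. *)
Lemma cl_div_term S S' e t f : T e t -> t != 0 ->
  (forall i, S i -> e <= i -> S' (i - e)) -> cl S f -> (e%:E <= v f)%E ->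
  cl S' (f / t).
Proof.
move=> Tt t0 SS' Sf ef a.
pose b := Num.max (a + e) e.
have [y Sy ay] := Sf b.
have ey : (e%:E <= v y)%E.
  have -> : y = f - (f - y) by ring.
  by apply: (valB_ge vP) => //; apply: le_trans ay; rewrite lee_fin le_max lexx orbT.
have [w [s [gw yE wS]]] := fsum_graded Sy.
exists (y / t).
  rewrite yE mulr_suml; apply: fsum_sum => i _.
  have [->|wi] := eqVneq (w i) 0; first by rewrite mul0r; apply: fsum0.
  apply: (@fsum_term _ (i - e)).
    apply: SS'; first exact: wS.
    rewrite leNgt; apply/negP; rewrite yE in ey => /(graded_low gw ey)/eqP.
    exact/negP.
  by apply: (tsM tsP) (gw.2 i wi).2 _; apply: (tsV tsP).
rewrite -mulrBl -[a](addrK e); apply: (valM_ge vP); last first.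
  by rewrite (valV vP (ts_val tsP Tt t0)).
by apply: le_trans ay; rewrite lee_fin le_max lexx.
Qed.

(** The component of degree v f of a good approximation of f. *)
Lemma leading_term S f : cl S f -> f != 0 -> exists e t,
  [/\ T e t, t != 0, v f = e%:E & (e%:E < v (f - t)%R)%E].
Proof.
move=> Sf f0; have [e ve] := val_fin vP f0.
have [y Sy ay] := Sf (e + 1).
have lt : (e%:E < v (f - y)%R)%E.
  by apply: lt_le_trans ay; rewrite lte_fin ltrDl.
have vy : v y = e%:E by apply: (val_dominant vP ve); rewrite (valBC vP).
have [w [s [gw yE _]]] := fsum_graded Sy.
have low i : i < e -> w i = 0.
  by apply: (graded_low gw); rewrite -yE vy.
have tail := graded_tail_gt gw low; rewrite -yE in tail.
have we : w e != 0.
  by apply/eqP => we; move: tail; rewrite we subr0 vy ltxx.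
exists e, (w e); split=> //; first exact: (gw.2 e we).2.
have -> : f - w e = (f - y) + (y - w e) by ring.
exact: valD_gt.
Qed.

Lemma horner_sub_ge (p : {poly K}) x y b : (forall k, (0 <= v p`_k)%E) ->
  (0 <= v x)%E -> (0 <= v y)%E -> (b%:E <= v (x - y)%R)%E ->
  (b%:E <= v (p.[x] - p.[y])%R)%E.
Proof.
move=> p0 x0 y0 bxy; rewrite !horner_coef -sumrB; apply: (val_sum_ge vP) => i _.
rewrite -mulrBr subrXX mulrC -mulrA; apply: (valM0_ge vP) => //.
rewrite -[0%E]/(0%:E) -[0]addr0; apply: (valM_ge vP) => //.
apply: (val_sum_ge vP) => j _; rewrite -[0]addr0.
by apply: (valM_ge vP); apply: (valX0_ge vP).
Qed.

Lemma val_gt0_real x : (0 < v x)%E -> exists2 a, 0 < a & (a%:E <= v x)%E.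
Proof.
have [->|/(val_fin vP)[a ->]] := eqVneq x 0.
  by exists 1; rewrite // (val0 vP) leey.
by rewrite lte_fin => a0; exists a.
Qed.

(** The iterates of A from 0 stay in the closure and converge to u: since the
    linear coefficient has positive valuation, A contracts on the elements of
    valuation at least rho > 0. *)
Lemma cl_fixpoint S (A : {poly K}) u : S 0 -> (forall i j, S i -> S j -> S (i + j)) ->
  (forall i, S i -> 0 <= i) -> (forall k, cl S A`_k) -> (0 < v A`_1%N)%E ->
  u = A.[u] -> (0 < v u)%E -> cl S u.
Proof.
move=> S0 SD Sge SA A1 uA u0.
have [r1 r10 hr1] := val_gt0_real A1; have [r2 r20 hr2] := val_gt0_real u0.
pose rho := Num.min r1 r2.
have rho0 : 0 < rho by rewrite lt_min r10.
have rhoA : (rho%:E <= v A`_1%N)%E by apply: le_trans hr1; rewrite lee_fin ge_min lexx.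
have rhou : (rho%:E <= v u)%E by apply: le_trans hr2; rewrite lee_fin ge_min lexx orbT.
pose it n := iter n (fun y => A.[y]) 0.
have cl_it n : cl S (it n).
  elim: n => [|n IH]; first exact: cl0.
  exact: cl_horner.
have contract y b : (rho%:E <= v y)%E -> (b%:E <= v (u - y)%R)%E ->
    ((rho + b)%:E <= v (A.[u] - A.[y])%R)%E.
  move=> ry bu; rewrite !horner_coef -sumrB; apply: (val_sum_ge vP) => -[i isz] _ /=.
  rewrite -mulrBr; case: i isz => [|[|i]] _.
  - by rewrite subrr mulr0 (val0 vP) leey.
  - by rewrite !expr1; apply: (valM_ge vP).
  rewrite mulrC; apply: (valM0_ge vP); last exact: cl_ge0 (SA _).
  rewrite subrXX addrC; apply: (valM_ge vP) => //; apply: (val_sum_ge vP) => -[j jlt] _ /=.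
  have v0 z : (rho%:E <= v z)%E -> (0 <= v z)%E.
    by apply: le_trans; rewrite lee_fin ltW.
  case: j jlt => [|j] _.
    rewrite subn0 expr0 mulr1 exprS; apply: (valM0_ge vP) => //.
    by apply: (valX0_ge vP); apply: v0.
  rewrite mulrC exprS -mulrA; apply: (valM0_ge vP) => //.
  rewrite -[0%E]/(0%:E) -[0]addr0.
  by apply: (valM_ge vP); apply: (valX0_ge vP); apply: v0.
have conv n : ((rho *+ n.+1)%:E <= v (u - it n)%R)%E.
  elim: n => [|n IH]; first by rewrite subr0.
  rewrite {1}uA [it n.+1]/= mulrS; apply: contract => //.
  have -> : it n = u - (u - it n) by ring.
  apply: (valB_ge vP) => //; apply: le_trans IH.
  by rewrite lee_fin mulrS lerDl mulrn_wge0 // ltW.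
apply: cl_limit => a; exists (it (Num.trunc (a / rho))) => //.
apply: le_trans (conv _); rewrite lee_fin.
have := truncnS_gt (a / rho); rewrite ltr_pdivrMr // mulrC mulr_natr.
exact: ltW.
Qed.

End TermSystems.

(** * Elements with finitely generated support *)

Section FinitelyGeneratedSupport.
Context {R : realType} {K : fieldType} {v : K -> \bar R} {T : R -> set K}.
Hypotheses (vP : valuation v) (tsP : term_system v T).
Implicit Types (x y t : K) (a e i : R) (l : seq R).

Local Notation cl := (@cl R K v T).
Local Notation nonneg l := (forall g, g \in l -> 0 <= g).

Lemma val_div_gt0 x t e : v t = e%:E -> (e%:E < v x)%E -> (0 < v (x / t)%R)%E.
Proof.
move=> vt lt; rewrite (valM vP) (valV vP vt).
have [->|/(val_fin vP)[c vc]] := eqVneq x 0; first by rewrite (val0 vP) addye.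
by move: lt; rewrite vc lte_fin -EFinD lte_fin subr_gt0.
Qed.

(** The inverse is a geometric series: x is its leading term times 1 - b, with b
    of positive valuation. *)
Lemma cl_inv x : cl setT x -> cl setT x^-1.
Proof.
move=> Tx; have [->|x0] := eqVneq x 0; first by rewrite invr0; apply: cl0 vP _.
have [e [t [Tt t0 ve lt]]] := leading_term vP tsP Tx x0.
pose b := 1 - x / t.
have vt := ts_val tsP Tt t0.
have Tti : cl setT t^-1 by apply: (cl_fsum vP); apply: fsum_term (tsV tsP Tt t0).
have Tb : cl setT b.
  apply: (clB vP tsP); first exact: (cl1 vP tsP).
  exact: (clM vP tsP).
have b0 : (0 < v b)%E.
  have -> : b = (t - x) / t by rewrite /b mulrBl divff.
  by apply: val_div_gt0 vt _; rewrite (valBC vP).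
have [rho rho0 hrho] := val_gt0_real vP b0.
apply: (cl_limit vP) => a; pose n := (Num.trunc ((a + e) / rho)).+1.
exists (t^-1 * \sum_(k < n) b ^+ k).
  apply: (clM vP tsP) => //; apply: (cl_sum vP tsP) => k _.
  exact: (clX vP tsP).
have -> : x^-1 - t^-1 * \sum_(k < n) b ^+ k = x^-1 * b ^+ n.
  have xb : b - 1 = - (x / t) by rewrite /b; ring.
  have -> : b ^+ n = 1 - x / t * \sum_(k < n) b ^+ k.
    by rewrite -[LHS](subrK 1) subrX1 xb mulNr addrC.
  by rewrite mulrBr mulr1 !mulrA mulVf // mul1r.
have := valM_ge vP (_ : ((- e)%:E <= v x^-1)%E) (valX_ge vP n hrho).
rewrite (valV vP ve) lexx => /(_ isT); apply: le_trans; rewrite lee_fin.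
have := truncnS_gt ((a + e) / rho); rewrite -/n ltr_pdivrMr // mulr_natl.
by lra.
Qed.

Definition fgring : set K := [set x | exists2 l : seq R, nonneg l & cl (sgen l) x].

Lemma fgring_ge0 x : fgring x -> (0 <= v x)%E.
Proof. by move=> [l l0]; apply: (cl_ge0 vP tsP); apply: sgen_ge0. Qed.

Lemma nonneg_cat l l' : nonneg l -> nonneg l' -> nonneg (l ++ l').
Proof. by move=> h h' g; rewrite mem_cat => /orP[/h|/h']. Qed.

Lemma cl_catl l l' x : cl (sgen l) x -> cl (sgen (l ++ l')) x.
Proof. by apply: cl_mono; apply: sgen_sub => g; rewrite mem_cat => ->. Qed.

Lemma cl_catr l l' x : cl (sgen l') x -> cl (sgen (l ++ l')) x.
Proof. by apply: cl_mono; apply: sgen_sub => g; rewrite mem_cat orbC => ->. Qed.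

Lemma fgring1 : fgring 1.
Proof. by exists [::] => //; apply: (cl1 vP tsP); apply: sgen0. Qed.

Lemma fgringB x y : fgring x -> fgring y -> fgring (x - y).
Proof.
move=> [l l0 lx] [l' l0' ly]; exists (l ++ l'); first exact: nonneg_cat.
by apply: (clB vP tsP); [apply: cl_catl | apply: cl_catr].
Qed.

Lemma fgringM x y : fgring x -> fgring y -> fgring (x * y).
Proof.
move=> [l l0 lx] [l' l0' ly]; exists (l ++ l'); first exact: nonneg_cat.
apply: (clM vP tsP); [exact: sgenD | exact: cl_catl | exact: cl_catr].
Qed.

Lemma fgringMn x n : fgring x -> fgring (x *+ n).
Proof. by move=> [l l0 lx]; exists l => //; apply: (clMn vP tsP _). Qed.

Lemma fgring_poly_common (p : {poly K}) : poly_over fgring p ->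
  exists2 l, nonneg l & forall k, cl (sgen l) p`_k.
Proof.
move=> pV.
have [l l0 hl] : exists2 l, nonneg l & forall x, x \in (p : seq K) -> cl (sgen l) x.
  have : forall x, x \in (p : seq K) -> fgring x.
    by move=> x /(nthP 0)[k _ <-]; apply: pV.
  elim: (p : seq K) => [|x s IH] sV; first by exists [::].
  have [|l l0 hl] := IH; first by move=> y ys; apply: sV; rewrite inE ys orbT.
  have [l' l0' hl'] := sV x (mem_head _ _).
  exists (l ++ l'); first exact: nonneg_cat.
  move=> y; rewrite inE => /orP[/eqP ->|/hl h]; [exact: cl_catr | exact: cl_catl].
exists l => // k; have [lt|le] := ltnP k (size p); first exact/hl/mem_nth.
by rewrite nth_default //; apply: (cl0 vP).
Qed.

Hypothesis dense : forall x, (0 <= v x)%E -> cl setT x.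

Lemma fgring_approx x a : (0 <= v x)%E -> 0 <= a ->
  exists2 y, fgring y & (a%:E <= v (x - y)%R)%E.
Proof.
move=> x0 a0; have [y Ty ay] := dense x0 a; exists y => //.
have y0 : (0%:E <= v y)%E.
  have -> : y = x - (x - y) by ring.
  by apply: (valB_ge vP) => //; apply: le_trans ay; rewrite lee_fin.
have [w [s [gw yE _]]] := fsum_graded tsP Ty.
exists [seq i <- s | 0 <= i] => [g|]; first by rewrite mem_filter => /andP[].
apply: (cl_fsum vP); rewrite yE; apply: (graded_fsum gw) => i wi.
apply: sgen_gen; rewrite mem_filter (gw.2 i wi).1 andbT leNgt.
by apply/negP => i0; move/eqP: wi; apply; move: i i0; apply: (graded_low vP tsP gw); rewrite -yE.
Qed.

Hypothesis char0 : [pchar K] =i pred0.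

(** Newton's method around an approximate root y of x: with h = x - y and t the
    leading term of p'(y), Taylor's formula turns p(x) = 0 into a fixpoint
    equation for u = h / t, whose coefficients p^(m)(y)/m! t^m / t^2 have
    supports in one finitely generated semigroup. *)
Lemma fgring_simple_root (p : {poly K}) x : poly_over fgring p -> (0 <= v x)%E ->
  p.[x] = 0 -> p^`().[x] != 0 -> fgring x.
Proof.
move=> pV x0 px dpx.
have p_ge0 k : (0 <= v p`_k)%E by apply/fgring_ge0/pV.
have dp_ge0 k : (0 <= v p^`()`_k)%E.
  by apply: fgring_ge0; rewrite coef_deriv; apply: fgringMn; apply: pV.
have [e ve] := val_fin vP dpx.
have e0 : 0 <= e.
  by rewrite -lee_fin -ve; apply: (val_horner_ge vP).
(* Precision beyond 2e makes p(y) / t^2 small, as Hensel's lemma requires. *)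
have vh_ge : 0 <= e + e + 1 by lra.
have [y yV hy] := fgring_approx x0 vh_ge.
have y0 := fgring_ge0 yV.
have [l1 l1n yl1] := yV; have [l2 l2n pl2] := fgring_poly_common pV.
pose l := e :: l1 ++ l2.
have ln : nonneg l.
  by move=> g; rewrite inE => /orP[/eqP -> //|]; apply: nonneg_cat.
have sub12 : {subset l1 ++ l2 <= l} by move=> g gl; rewrite inE gl orbT.
have yl : cl (sgen l) y by apply: cl_mono (sgen_sub sub12) (cl_catl _ yl1).
have pl k : cl (sgen l) p`_k by apply: cl_mono (sgen_sub sub12) (cl_catr _ (pl2 k)).
have SD := @sgenD R l; have S0 := sgen0 l.
pose f m := (p^`N(m)).[y].
have fl m : cl (sgen l) (f m).
  apply: (cl_horner vP tsP) => // k; rewrite coef_nderivn; exact: (clMn vP tsP _).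
have f_ge0 m : (0 <= v (f m))%E by apply: (cl_ge0 vP tsP) (fl m); apply: sgen_ge0.
have f0E : f 0%N = p.[y] by rewrite /f poly.nderivn0.
have f1E : f 1%N = p^`().[y] by rewrite /f poly.nderivn1.
have vf0 : ((e + e)%:E <= v (f 0%N))%E.
  rewrite f0E -[p.[y]]subr0 -px (valBC vP).
  by apply: (horner_sub_ge vP) => //; apply: le_trans hy; rewrite lee_fin; lra.
have vf1 : v (f 1%N) = e%:E.
  apply: (val_dominant vP ve); rewrite f1E (valBC vP).
  apply: (@lt_le_trans _ _ (e + e + 1)%:E); first by rewrite lte_fin; lra.
  exact: (horner_sub_ge vP).
have [e' [t [Tt t0 ve' lt]]] := leading_term vP tsP (fl 1%N) (val_neq0 vP vf1).
move: ve' Tt lt; rewrite vf1 => -[<-] Tt lt {e'}.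
have vt := ts_val tsP Tt t0.
have tl : cl (sgen l) t.
  by apply: (cl_fsum vP); apply: fsum_term Tt; apply: sgen_gen; rewrite inE eqxx.
have [l3 l3n shift] := sgen_shift (e + e) ln.
have Tt2 : T (e + e) (t ^+ 2) by apply: (tsM tsP).
have t20 : t ^+ 2 != 0 by rewrite expf_neq0.
have gl m : cl (sgen l3) (f m * t ^+ m / t ^+ 2).
  apply: (cl_div_term vP tsP Tt2 t20 shift).
    by apply: (clM vP tsP) => //; apply: (clX vP tsP).
  case: m => [|m]; first by rewrite expr0 mulr1.
  have vtm : (0%:E <= v (t ^+ m))%E by apply: (valX0_ge vP); rewrite vt lee_fin.
  case: m vtm => [|m] vtm; first by rewrite expr1 (valM vP) vf1 vt.
  rewrite mulrC; apply: (valM0_ge vP) => //; rewrite !exprS mulrA.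
  apply: (valM0_ge vP); first by apply: (valM_ge vP); rewrite vt.
  apply: (valX0_ge vP); by rewrite vt lee_fin.
pose h := x - y; pose u := h / t.
have xE : x = y + u * t by rewrite /u divfK // /h addrC subrK.
have u0 : (0 < v u)%E.
  apply: (@lt_le_trans _ _ (e + e + 1 - e)%:E); first by rewrite lte_fin; lra.
  by apply: (valM_ge vP) => //; rewrite (valV vP vt).
pose A := 'X - \poly_(m < size p) (f m * t ^+ m / t ^+ 2).
have Au : u = A.[u].
  rewrite /A hornerD hornerX hornerN horner_poly -[LHS]subr0; congr (_ - _).
  transitivity (p.[y + u * t] / t ^+ 2); first by rewrite -xE px mul0r.
  rewrite nderiv_taylor; last exact: mulrC.
  rewrite mulr_suml; apply: eq_bigr => m _; rewrite exprMn -/(f m).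
  by rewrite mulrAC -!mulrA [u ^+ m * _]mulrC !mulrA [f m * _ * _]mulrAC.
have l13n : nonneg (l ++ l3) by apply: nonneg_cat.
have ul : cl (sgen (l ++ l3)) u.
  apply: (cl_fixpoint vP tsP (A := A)) => //.
  - exact: sgen0.
  - exact: sgenD.
  - exact: sgen_ge0.
  - move=> k; rewrite coefB coefX coef_poly; apply: (clB vP tsP).
      by case: eqP => _; [apply: (cl1 vP tsP); apply: sgen0 | apply: (cl0 vP)].
    by case: ifP => _; [apply: cl_catr | apply: (cl0 vP)].
  - rewrite coefB coefX coef_poly /=; have [lp|gp] := ltnP 1 (size p); last first.
      by case/eqP: dpx; rewrite (size1_polyC gp) derivC horner0.
    have -> : 1 - f 1%N * t ^+ 1 / t ^+ 2 = (t - f 1%N) / t by field.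
    by apply: val_div_gt0 vt _; rewrite (valBC vP).
exists (l ++ l3) => //; rewrite xE; apply: (clD vP tsP); first exact: cl_catl.
by apply: (clM vP tsP); [exact: sgenD | | exact: cl_catl].
Qed.

(** A root of p is either simple or a root of the derivative of p, which is
    nonzero in characteristic zero and has smaller degree. *)
Lemma fgring_algebraic (p : {poly K}) x : p != 0 -> poly_over fgring p ->
  root p x -> (0 <= v x)%E -> fgring x.
Proof.
elim: {p}(size p) {-2}p (leqnn (size p)) => [|n IH] p.
  by rewrite size_poly_leq0 => ->.
move=> sp p0 pV px x0.
have [d0|dn0] := eqVneq p^`().[x] 0; last first.
  by apply: fgring_simple_root pV x0 _ dn0; apply/eqP.
have sp1 : (1 < size p)%N.
  rewrite ltnNge; apply/negP => /size1_polyC pc; move: px p0; rewrite pc.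
  by rewrite rootC polyC_eq0 => ->.
apply: (IH p^`()) => //.
- by rewrite -ltnS (leq_trans (lt_size_deriv p0)).
- apply/eqP => /polyP/(_ (size p).-2)/eqP; apply/negP.
  rewrite coef_deriv coef0 -mulr_natr mulf_neq0 //.
    by rewrite -subn2 -subSn // subn2 /= -lead_coefE lead_coef_eq0.
  by rewrite (proj1 (pcharf0P K) char0).
- by move=> k; rewrite coef_deriv; apply: fgringMn.
- exact/eqP.
Qed.

Lemma fgring_closed_subring : closed_subring v fgring.
Proof.
split; [exact: fgring_ge0 | exact: fgring1 | exact: fgringB | exact: fgringM |].
by move=> x p p0 pV px x0; apply: fgring_algebraic pV px x0.
Qed.

End FinitelyGeneratedSupport.

(** * Expansions *)

Section ExpansionRing.
Context {R : realType} {n : nat} {k Khat : fieldType}.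
Local Notation K := {fraction mfps n k}.
Context {nu : K -> \bar R} {iota : {rmorphism K -> Khat}} {nuhat : Khat -> \bar R}.
Hypothesis completion : val_completion nu iota nuhat.
Context {T : R -> set Khat}.
Let vP : valuation nuhat := completion_val completion.
Hypothesis tsP : term_system nuhat T.

(** Completion is an immediate extension: x has the valuation of any element
    of K close enough to it. *)
Lemma completion_value_group x i : 0 <= i -> nuhat x = i%:E -> value_group nu i.
Proof.
move=> i0 vx; have x0 : val_ring nuhat x by rewrite /val_ring /= vx lee_fin.
have [y _ hy] := completion_dense completion x0 (i + 1).
have vy : nuhat (iota y) = i%:E.
  apply: (val_dominant vP vx); rewrite (valBC vP).
  by apply: lt_le_trans hy; rewrite lte_fin ltrDl.
exists y; last by rewrite -(completion_ext completion).
by have := val_neq0 vP vy; rewrite fmorph_eq0.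
Qed.

Lemma fgring_expansion x : fgring (v := nuhat) (T := T) x ->
  exists w, expansion nu nuhat T x w /\
    exists s (g : 'I_s -> R),
       (forall j, 0 <= g j) /\ [set i | w i != 0] `<=` semigroup_gen g.
Proof.
move=> [l l0 lx].
have /choice[y hy] : forall a, exists y, fsum (T := T) (sgen l) y /\ (a%:E <= nuhat (x - y)%R)%E.
  by move=> a; have [y ? ?] := lx a; exists y.
have /choice[ws hws] : forall a, exists ws : (R -> Khat) * seq R,
    [/\ graded (T := T) ws.1 ws.2, y a = \sum_(i <- ws.2) ws.1 i &
      forall i, ws.1 i != 0 -> sgen l i].
  by move=> a; have [w [s h]] := fsum_graded tsP (hy a).1; exists (w, s).
(* The term of degree i is read off any approximation beyond i. *)
pose w i := (ws (i + 1)).1 i.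
have wE a i : i < a -> (ws a).1 i = w i.
  move=> ia; have [ga yE _] := hws a; have [gi yiE _] := hws (i + 1).
  apply: (graded_unique vP tsP ga gi (a := Num.min a (i + 1))); last first.
    by rewrite lt_min ia ltrDl ltr01.
  rewrite -yE -yiE; apply: (val_trans vP (y := x)).
    rewrite (valBC vP); apply: le_trans (hy a).2.
    by rewrite lee_fin ge_min lexx.
  by apply: le_trans (hy (i + 1)).2; rewrite lee_fin ge_min lexx orbT.
have wl i : w i != 0 -> sgen l i by have [_ _] := hws (i + 1); apply.
have wT i : w i != 0 -> T i (w i).
  by move=> wi; have [[_ h] _ _] := hws (i + 1); apply: (h i wi).2.
exists w; split; last first.
  exists (size l), (fun j : 'I_(size l) => l`_j); split.
    by move=> j; apply: l0; apply: mem_nth.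
  by move=> i /= /wl; apply: sgen_semigroup_gen.
split.
- exact: wT.
- move=> i wi; have i0 : 0 <= i by apply: (sgen_ge0 l0); apply: wl.
  split=> //; apply: (completion_value_group (x := w i)) => //.
  exact: (ts_val tsP (wT i wi) wi).
- by apply: (sgen_discrete l0) => i /=; apply: wl.
move=> mu; exists mu => lam mulam.
have [[us hs] yE _] := hws lam.
have -> : \sum_(i \in [set i | i < lam]) w i = \sum_(i <- (ws lam).2 | i < lam) (ws lam).1 i.
  rewrite (eq_fsbigr (ws lam).1); last first.
    by move=> i; rewrite inE /= => /wE ->.
  rewrite [RHS]bigfs // => i _ ins.
  by apply/eqP/negPn/negP => /hs[]; rewrite (negbTE ins).
have -> : x - \sum_(i <- (ws lam).2 | i < lam) (ws lam).1 i =
    (x - y lam) + \sum_(i <- (ws lam).2 | ~~ (i < lam)) (ws lam).1 i.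
  by rewrite yE [in X in _ = x - X + _](bigID (fun i => i < lam)) /=; ring.
apply: (valD_ge vP).
  by apply: le_trans (hy lam).2; rewrite lee_fin.
apply: (val_sum_ge vP) => i; rewrite -leNgt => il.
have [->|wi] := eqVneq ((ws lam).1 i) 0; first by rewrite (val0 vP) leey.
rewrite (ts_val tsP (hs i wi).2 wi) lee_fin; exact: le_trans il.
Qed.

Lemma Vfg_fgring : Vfg nu nuhat T = fgring (v := nuhat) (T := T).
Proof.
apply/seteqP; split=> x; last first.
  move=> fx; split; first exact: (fgring_ge0 vP tsP fx).
  exact: fgring_expansion.
move=> [_ [w [[wT _ _ wsum] [s [g [g0 supp]]]]]].
exists (codom g) => [_ /codomP[j ->] // |a].
have [lam hlam] := wsum a.
exists (\sum_(i \in [set i | i < lam]) w i); last exact: hlam.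
apply: fsum_sum => i _.
have [->|wi] := eqVneq (w i) 0; first exact: fsum0.
by apply: (fsum_term (i := i)); [apply: semigroup_gen_sgen; apply: supp | apply: wT].
Qed.

End ExpansionRing.

(** * Truncation of power series *)

Section SeriesTruncation.
Context {R : realType} {n : nat} {k : fieldType}.
Implicit Types (w : 'I_n -> R) (f : mfps n k) (a : R).

Lemma wdegD w m m' : wdeg w (mnm_add m m') = wdeg w m + wdeg w m'.
Proof.
by rewrite /wdeg -big_split; apply: eq_bigr => j _; rewrite mnmDE mulrnDr.
Qed.

Lemma wdeg0 w : wdeg w (@mnm0 n) = 0.
Proof. by rewrite /wdeg big1 // => j _; rewrite mnm0E mulr0n. Qed.

Lemma wdeg_large w a : (forall j, 0 < w j) ->
  exists D, forall m : multinom n, (D <= mdeg m)%N -> a <= wdeg w m.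
Proof.
move=> w0.
have [e e0 he] : exists2 e, 0 < e & forall j, e <= w j.
  suff [e e0 he] : exists2 e, 0 < e & forall x, x \in codom w -> e <= x.
    by exists e => // j; apply: he; apply: codom_f.
  have : forall x, x \in codom w -> 0 < x by move=> _ /codomP[j ->].
  elim: (codom w) => [|x s IH] s0; first by exists 1.
  have [|e e0 he] := IH; first by move=> y ys; apply: s0; rewrite inE ys orbT.
  exists (Num.min x e); first by rewrite lt_min e0 s0 ?mem_head.
  move=> y; rewrite inE => /orP[/eqP -> |/he]; first by rewrite ge_min lexx.
  by apply: le_trans; rewrite ge_min lexx orbT.
exists (Num.trunc (a / e)).+1 => m Dm.
have := truncnS_gt (a / e); rewrite ltr_pdivrMr // => /ltW/le_trans; apply.
apply: (@le_trans _ _ ((mdeg m)%:R * e)).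
  by rewrite ler_wpM2r ?(ltW e0) // ler_nat.
rewrite mdegE natr_sum mulr_suml; apply: ler_sum => j _.
by rewrite mulr_natl lerMn2r he orbT.
Qed.

Lemma monomial_val_ge w f a : (forall m, fcoef f m != 0 -> a <= wdeg w m) ->
  (a%:E <= monomial_val w f)%E.
Proof. by move=> h; apply/ereal_infP => _ [m /= /h aw <-]; rewrite lee_fin. Qed.

Lemma monomial_val_homog w f m s : fcoef f m != 0 ->
  (forall m', fcoef f m' != 0 -> wdeg w m' = s) -> monomial_val w f = s%:E.
Proof.
move=> fm h; apply/eqP; rewrite eq_le monomial_val_ge ?andbT; last first.
  by move=> m' /h ->.
by apply: ereal_inf_lbound; exists m => //=; rewrite h.
Qed.

Lemma trunc_val_ge w f a : (forall j, 0 < w j) ->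
  exists D, (a%:E <= monomial_val w (f - mfps_of_mpoly (ftrunc D f))%R)%E.
Proof.
move=> /(wdeg_large a)[D hD]; exists D; apply: monomial_val_ge => m.
have [lt|ge] := ltnP (mdeg m) D; last by move=> _; apply: hD.
by rewrite /= ftruncE // subrr eqxx.
Qed.

End SeriesTruncation.

Lemma fractionE (A : idomainType) (x : {fraction A}) :
  exists a b : A, b != 0 /\ x = tofrac a / tofrac b.
Proof.
elim/quotW: x => -[[a b] /= b0]; exists a, b; split=> //.
apply: (canRL (mulfK _)); first by rewrite tofrac_eq0.
rewrite -[LHS]/(FracField.mul _ _) !piE; apply/eqmodP.
rewrite /= FracField.equivfE !numden_Ratio ?mulf_neq0 ?oner_eq0 //.
by rewrite /= !mulr1 mulrC.
Qed.

(** * The two systems of terms *)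

Lemma val_exprz (R : realType) (F : fieldType) (v : F -> \bar R) (x : F) (a : R) (m : int) :
  valuation v -> v x = a%:E -> v (x ^ m) = (a *~ m)%:E.
Proof.
move=> vP' vx; case: m => m; first by rewrite -exprnP (valX vP' m vx).
by rewrite NegzE -invr_expz mulrNz (valV vP' (valX vP' m.+1 vx)).
Qed.

Lemma val_prod (R : realType) (F : fieldType) (v : F -> \bar R) (I : Type) (s : seq I)
    (f : I -> F) (a : I -> R) :
  valuation v -> (forall i, v (f i) = (a i)%:E) ->
  v (\prod_(i <- s) f i) = (\sum_(i <- s) a i)%:E.
Proof.
move=> vP' vf; elim: s => [|i s IH]; first by rewrite !big_nil (val1 vP').
by rewrite !big_cons (valM vP') vf IH.
Qed.

Section Uniformized.
Context {R : realType} {n : nat} {k : fieldType} {Khat : fieldType}.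
Local Notation K := {fraction mfps n k}.
Context {nu : K -> \bar R} {iota : {rmorphism K -> Khat}} {nuhat : Khat -> \bar R}.
Hypothesis completion : val_completion nu iota nuhat.
Hypothesis nuP : valuation nu.
Variable U : uniformization nu iota nuhat.
Let vP : valuation nuhat := completion_val completion.
Let th := un_theta U.
Let zK j : K := un_frac U (un_z j).
Let wt : 'I_(un_r U) -> R := un_wt (u := U).

Let nu_zK j : nu (zK j) = (wt j)%:E. Proof. exact: un_wtE. Qed.

Lemma theta_const_val c : c != 0 -> nuhat (th (fconst c)) = 0%:E.
Proof.
move=> c0; rewrite un_monomial (@monomial_val_homog _ _ _ _ _ (@mnm0 _) 0) //.
  by rewrite /= mcoeffC eqxx mulr1.
move=> m; have [-> _|/negbTE m0] := eqVneq m (@mnm0 _); first exact: wdeg0.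
by rewrite /= mcoeffC m0 mulr0 eqxx.
Qed.

Let zprod_val (b : 'I_(un_r U) -> int) :
  nu (\prod_j zK j ^ b j) = (\sum_j wt j *~ b j)%:E.
Proof. by apply: (val_prod _ nuP) => j; apply: (val_exprz _ nuP). Qed.

Let zprodE (b : 'I_(un_r U) -> int) :
  \prod_j iota (zK j) ^ b j = iota (\prod_j zK j ^ b j).
Proof. by rewrite rmorph_prod; apply: eq_bigr => j _; rewrite fmorphXz. Qed.

Let zK0 j : zK j != 0. Proof. exact: (val_neq0 nuP (nu_zK j)). Qed.

(* un_wt_free says that the weights are independent over the integers. *)
Let exponent_unique (b b' : 'I_(un_r U) -> int) :
  \sum_j wt j *~ b j = \sum_j wt j *~ b' j -> b =1 b'.
Proof.
move=> e; have gp : value_group nu (\sum_j wt j *~ b j).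
  by exists (\prod_j zK j ^ b j); rewrite ?zprod_val // (val_neq0 nuP (zprod_val b)).
have [b0 [_ u]] := un_wt_free U gp.
have eb : b0 = finfun b.
  by apply: u; apply: eq_bigr => j _; rewrite ffunE.
have eb' : b0 = finfun b'.
  by apply: u; rewrite e; apply: eq_bigr => j _; rewrite ffunE.
by move=> j; have := congr1 (fun f : {ffun _} => f j) (etrans (esym eb) eb'); rewrite !ffunE.
Qed.

Lemma uniformized_term_system : term_system nuhat (uniformized_terms U).
Proof.
have fcD c d : fconst (c + d) = fconst c + fconst d :> mfps (un_r U) (un_L U).
  by rewrite /fconst mpolyCD rmorphD.
have fcM c d : fconst (c * d) = fconst c * fconst d :> mfps (un_r U) (un_L U).
  by rewrite /fconst mpolyCM rmorphM.
have fc1 : fconst 1 = 1 :> mfps (un_r U) (un_L U).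
  by rewrite /fconst -[RHS](rmorph1 (@mfps_of_mpoly _ _)).
have fc0 : fconst 0 = 0 :> mfps (un_r U) (un_L U).
  by rewrite /fconst mpolyC0 rmorph0.
have fcN c : fconst (- c) = - fconst c :> mfps (un_r U) (un_L U).
  by apply/eqP; rewrite -addr_eq0 -fcD addNr fc0.
split.
- move=> i t [c [b [<- ->]]]; rewrite zprodE => t0.
  have c0 : c != 0 by apply: contraNneq t0 => ->; rewrite fc0 rmorph0 mul0r.
  by rewrite (valM vP) theta_const_val // (completion_ext completion) zprod_val add0e.
- exists 1, (fun=> 0); split; first by rewrite big1 // => j _; rewrite mulr0z.
  by rewrite fc1 rmorph1 mul1r big1 // => j _; rewrite expr0z.
- move=> i s t [c [b [bi ->]]] [c' [b' [bi' ->]]] _.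
  exists (c + c'), b; split=> //; rewrite fcD rmorphD mulrDl; congr (_ + _ * _).
  have /exponent_unique e : \sum_j wt j *~ b' j = \sum_j wt j *~ b j by rewrite bi.
  by apply: eq_bigr => j _; rewrite e.
- move=> i t [c [b [bi ->]]]; exists (- c), b; split=> //.
  by rewrite fcN rmorphN mulNr.
- move=> i j s t [c [b [bi ->]]] [c' [b' [bi' ->]]].
  exists (c * c'), (fun l => b l + b' l); split.
    by rewrite -bi -bi' -big_split; apply: eq_bigr => l _; rewrite mulrzDr.
  rewrite fcM rmorphM mulrACA -big_split; congr (_ * _); apply: eq_bigr => l _.
  by rewrite exprzDr // unitfE fmorph_eq0 zK0.
- move=> i t [c [b [bi ->]]]; rewrite zprodE => t0.
  have c0 : c != 0 by apply: contraNneq t0 => ->; rewrite fc0 rmorph0 mul0r.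
  exists c^-1, (fun l => - b l); split.
    by rewrite -bi -sumrN; apply: eq_bigr => l _; rewrite mulrNz.
  rewrite invfM zprodE -fmorphV -prodfV; congr (_ * _).
    apply: (@mulfI _ (th (fconst c))).
      by rewrite (val_neq0 vP (theta_const_val c0)).
    by rewrite -rmorphM -fcM !divff ?fc1 ?rmorph1 // (val_neq0 vP (theta_const_val c0)).
  by congr (iota _); apply: eq_bigr => l _; rewrite invr_expz.
Qed.

Local Notation cl := (cl (v := nuhat) (T := uniformized_terms U)).
Let tsP := uniformized_term_system.

Lemma theta_monomial c (m : multinom (un_r U)) :
  uniformized_terms U (wdeg wt m) (th (mfps_of_mpoly (c *: mpolyX _ m))).
Proof.
exists c, (fun j => (m j : int)); split; first by apply: eq_bigr.
rewrite -mul_mpolyC !rmorphM; congr (_ * _).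
rewrite mpolyXE_id !rmorph_prod; apply: eq_bigr => j _.
by rewrite !rmorphXn /= -un_thetaE un_psi_z.
Qed.

Lemma theta_dense f : cl setT (th f).
Proof.
move=> a; have [D hD] := trunc_val_ge f a (un_wt_gt0 (u := U)).
exists (th (mfps_of_mpoly (ftrunc D f))); last by rewrite -rmorphB un_monomial.
rewrite /ftrunc !rmorph_sum; apply: fsum_sum => m _.
exact: (fsum_term (i := wdeg wt m)) (theta_monomial _ _).
Qed.

(** The closure of the finite sums is a field containing the image of A, and
    the fractions of A are dense. *)
Lemma uniformized_dense x : (0 <= nuhat x)%E -> cl setT x.
Proof.
move=> x0; apply: (cl_limit vP) => a.
have [p [q [_ _ h]]] := un_dense U x0 a.
exists (iota (un_frac U p / un_frac U q)) => //.
rewrite fmorph_div -!un_thetaE; apply: (clM vP tsP) => //; first exact: theta_dense.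
by apply: (cl_inv vP tsP); apply: theta_dense.
Qed.

End Uniformized.

Section Homogeneous.
Context {R : realType} {n : nat} {k : fieldType} {Khat : fieldType}.
Local Notation K := {fraction mfps n k}.
Context {nu : K -> \bar R} {iota : {rmorphism K -> Khat}} {nuhat : Khat -> \bar R}.
Hypothesis completion : val_completion nu iota nuhat.
Hypothesis nuP : valuation nu.
Variable alpha : 'I_n -> R.
Hypothesis alpha_gt0 : forall j, 0 < alpha j.
Hypothesis nu_monomial : forall f : mfps n k, nu (tofrac f) = monomial_val alpha f.
Let vP : valuation nuhat := completion_val completion.
Implicit Types (p q : mpoly n k) (s : R).

Definition homog_of_deg s p := forall m, m \in msupp p -> wdeg alpha m = s.

Lemma homog_of_degM s s' p q : homog_of_deg s p -> homog_of_deg s' q ->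
  homog_of_deg (s + s') (p * q).
Proof.
move=> hp hq _ /msuppM_le/allpairsP[[m m'] [/= mp mq ->]].
by rewrite wdegD hp ?hq.
Qed.

Lemma homog_of_degD s p q : homog_of_deg s p -> homog_of_deg s q ->
  homog_of_deg s (p + q).
Proof. by move=> hp hq m /msuppD_le; rewrite mem_cat => /orP[/hp|/hq]. Qed.

Lemma homog_of_degN s p : homog_of_deg s p -> homog_of_deg s (- p).
Proof. by move=> hp m; rewrite (perm_mem (msuppN p)) => /hp. Qed.

Lemma homog1 : homog_of_deg 0 1.
Proof. by move=> m; rewrite msupp1 inE => /eqP ->; apply: wdeg0. Qed.

Lemma homog_val s p : p != 0 -> homog_of_deg s p -> nu (poly_frac p) = s%:E.
Proof.
move=> p0 hp; rewrite /poly_frac nu_monomial.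
have [m mp] : exists m, m \in msupp p.
  move: p0; rewrite -msupp_eq0; case: (msupp p) => [|m l] // _.
  by exists m; rewrite mem_head.
apply: (@monomial_val_homog _ _ _ _ _ m); first by rewrite /= -mcoeff_msupp.
by move=> m'; rewrite /= -mcoeff_msupp; apply: hp.
Qed.

Lemma poly_frac_neq0 p : p != 0 -> poly_frac p != 0.
Proof.
move=> p0; rewrite tofrac_eq0; apply: contra p0 => /eqP e; apply/eqP/mpolyP => m.
by have := congr1 (fun f => fcoef f m) e; rewrite /= mcoeff0.
Qed.

(** The degree of a fraction of homogeneous polynomials can be computed from
    the weighted degrees, since nu is monomial. *)
Lemma homogeneous_termsP i t : homogeneous_terms nu iota alpha i t <->
  t = 0 \/ exists p q s s', [/\ p != 0, q != 0, homog_of_deg s p, homog_of_deg s' q &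
    i = s - s' /\ t = iota (poly_frac p / poly_frac q)].
Proof.
split=> -[->|]; try by left.
  move=> [p [q [p0 q0 [[s hs] [s' hs']] e ->]]]; right; exists p, q, s, s'; split=> //.
  by split=> //; move: e; rewrite (homog_val p0 hs) (homog_val q0 hs') => -[<-].
move=> [p [q [s [s' [p0 q0 hs hs' [-> ->]]]]]]; right; exists p, q; split=> //.
  by split; [exists s | exists s'].
by rewrite (homog_val p0 hs) (homog_val q0 hs').
Qed.

Lemma homogeneous_term_system : term_system nuhat (homogeneous_terms nu iota alpha).
Proof.
have pfD p q : poly_frac (p + q) = poly_frac p + poly_frac q by rewrite /poly_frac !rmorphD.
have pfM p q : poly_frac (p * q) = poly_frac p * poly_frac q by rewrite /poly_frac !rmorphM.
have pfN p : poly_frac (- p) = - poly_frac p by rewrite /poly_frac !rmorphN.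
have pf1 : poly_frac 1 = 1 :> K by rewrite /poly_frac !rmorph1.
split.
- move=> i t /homogeneous_termsP[->|]; first by rewrite eqxx.
  move=> [p [q [s [s' [p0 q0 hs hs' [-> ->]]]]]] _.
  rewrite (completion_ext completion) (valM nuP) (homog_val p0 hs).
  by rewrite (valV nuP (homog_val q0 hs')).
- apply/homogeneous_termsP; right; exists 1, 1, 0, 0.
  split; rewrite ?oner_neq0 //; [exact: homog1|exact: homog1|].
  by rewrite subrr pf1 divr1 rmorph1.
- move=> i s t /homogeneous_termsP[->|]; first by rewrite add0r.
  move=> [p [q [a [b [p0 q0 hp hq [ei ->]]]]]].
  move=> /homogeneous_termsP[->|]; first rewrite addr0.
    by move=> _; apply/homogeneous_termsP; right; exists p, q, a, b.
  move=> [p' [q' [a' [b' [p0' q0' hp' hq' [ei' ->]]]]]].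
  have -> : iota (poly_frac p / poly_frac q) + iota (poly_frac p' / poly_frac q') =
     iota (poly_frac (p * q' + p' * q) / poly_frac (q * q')).
    rewrite -rmorphD addf_div ?poly_frac_neq0 // pfD !pfM; congr (iota (_ / _)).
  have [-> |num0] := eqVneq (p * q' + p' * q) 0.
    by rewrite /poly_frac !rmorph0 mul0r rmorph0 eqxx.
  move=> _; apply/homogeneous_termsP; right.
  exists (p * q' + p' * q), (q * q'), (a + b'), (b + b'); split=> //.
  + by rewrite mulf_neq0.
  + apply: homog_of_degD; first exact: homog_of_degM.
    have -> : a + b' = a' + b by move: ei'; rewrite ei => e; lra.
    exact: homog_of_degM.
  + exact: homog_of_degM.
  + by split=> //; rewrite ei; ring.
- move=> i t /homogeneous_termsP[->|]; first by rewrite oppr0; left.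
  move=> [p [q [a [b [p0 q0 hp hq [ei ->]]]]]]; apply/homogeneous_termsP; right.
  exists (- p), q, a, b; split; rewrite ?oppr_eq0 //; first exact: homog_of_degN.
  by rewrite pfN mulNr rmorphN.
- move=> i j s t /homogeneous_termsP[->|]; first by rewrite mul0r; left.
  move=> [p [q [a [b [p0 q0 hp hq [ei ->]]]]]].
  move=> /homogeneous_termsP[->|]; first by rewrite mulr0; left.
  move=> [p' [q' [a' [b' [p0' q0' hp' hq' [ei' ->]]]]]].
  apply/homogeneous_termsP; right.
  exists (p * p'), (q * q'), (a + a'), (b + b'); split; rewrite ?mulf_neq0 //;
    [exact: homog_of_degM | exact: homog_of_degM |].
  split; first by rewrite ei ei'; ring.
  by rewrite -rmorphM mulf_div !pfM.
- move=> i t /homogeneous_termsP[->|]; first by rewrite eqxx.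
  move=> [p [q [a [b [p0 q0 hp hq [ei ->]]]]]] _; apply/homogeneous_termsP; right.
  exists q, p, b, a; split=> //; split; first by rewrite ei opprB.
  by rewrite -fmorphV invf_div.
Qed.

Local Notation cl := (cl (v := nuhat) (T := homogeneous_terms nu iota alpha)).
Let tsP := homogeneous_term_system.

Lemma series_homogeneous_dense (f : mfps n k) : cl setT (iota (tofrac f)).
Proof.
move=> a; have [D hD] := trunc_val_ge f a alpha_gt0.
exists (iota (tofrac (mfps_of_mpoly (ftrunc D f)))); last first.
  by rewrite -!rmorphB (completion_ext completion) nu_monomial.
rewrite /ftrunc !rmorph_sum; apply: fsum_sum => m _.
have [c0|c0] := eqVneq (fcoef f m) 0.
  by rewrite c0 scale0r !rmorph0; apply: fsum0.
apply: (fsum_term (i := wdeg alpha m)) => //.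
apply/homogeneous_termsP; right.
exists (fcoef f m *: mpolyX k m), 1, (wdeg alpha m), 0; split.
- by rewrite -msupp_eq0 -size_eq0 (perm_size (msuppZ _ c0)) msuppX.
- exact: oner_neq0.
- move=> m'; rewrite (perm_mem (msuppZ _ c0)) msuppX inE => /eqP -> //.
- exact: homog1.
by rewrite subr0 /poly_frac !rmorph1 divr1.
Qed.

Lemma homogeneous_dense x : (0 <= nuhat x)%E -> cl setT x.
Proof.
move=> x0; apply: (cl_limit vP) => a.
have [y _ h] := completion_dense completion x0 a.
exists (iota y) => //; have [f [g [_ ->]]] := fractionE y.
rewrite fmorph_div; apply: (clM vP tsP) => //; first exact: series_homogeneous_dense.
by apply: (cl_inv vP tsP); apply: series_homogeneous_dense.
Qed.

End Homogeneous.

(** * The coefficient rings *)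

Section CoefficientRings.
Context {R : realType} {n : nat} {k : fieldType} {Khat : fieldType}.
Local Notation K := {fraction mfps n k}.
Context {nu : K -> \bar R} {iota : {rmorphism K -> Khat}} {nuhat : Khat -> \bar R}.
Hypothesis completion : val_completion nu iota nuhat.
Let vP : valuation nuhat := completion_val completion.

Lemma completion_cauchy_cvg (u : nat -> Khat) : val_cauchy nuhat u ->
  exists l, val_cvg nuhat u l.
Proof.
move=> cu; have [N hN] := cu 0.
pose u' i := u (N + i)%N - u N.
have [||l _ hl] := completion_complete completion (u := u').
- by move=> i; apply: hN => //; apply: leq_addr.
- move=> lam; have [M hM] := cu lam; exists M => i j iM jM.
  have -> : u' i - u' j = u (N + i)%N - u (N + j)%N by rewrite /u'; ring.
  by apply: hM; [apply: leq_trans iM _ | apply: leq_trans jM _]; apply: leq_addl.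
exists (l + u N) => lam; have [M hM] := hl lam; exists (N + M)%N => i iNM.
have Ni : (N <= i)%N by apply: leq_trans iNM; apply: leq_addr.
have := hM (i - N)%N; rewrite /u' subnKC // leq_subRL // => /(_ iNM).
by rewrite opprB addrA addrAC.
Qed.

Lemma char0_completion : [pchar k] =i pred0 -> [pchar Khat] =i pred0.
Proof.
move=> char0 p; rewrite !inE; apply/negP => /andP[p_prime].
rewrite -(rmorph_nat iota) fmorph_eq0 -(rmorph_nat (@tofrac (mfps n k))).
rewrite tofrac_eq0 => /eqP/(congr1 (@fcoef0 n k)); rewrite rmorph_nat rmorph0 => p0.
by have := char0 p; rewrite !inE p_prime p0 eqxx.
Qed.

Lemma Vhat_closed_subring : closed_subring nuhat (Vhat nuhat).
Proof.
split=> // [|x y|x y]; rewrite /Vhat /val_ring /=; first by rewrite (val1 vP).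
  exact: (valB_ge vP).
exact: (valM0_ge vP).
Qed.

Lemma Valg_closed_subring : closed_subring nuhat (Valg iota nuhat).
Proof.
have [_ h1 hB hM _] := Vhat_closed_subring; split.
- by move=> x [].
- by split => //; apply: algebraic1.
- by move=> x y [? ?] [? ?]; split; [apply: hB | apply: algebraic_sub].
- by move=> x y [? ?] [? ?]; split; [apply: hM | apply: algebraic_mul].
move=> x p p0 pV px x0; split=> //; apply/integral_algebraic.
apply: integral_root p0 px _ => _ /(nthP 0)[i _ <-].
by apply/integral_algebraic; have [] := pV i.
Qed.

Lemma coefficient_ring_closed_subring (V : set Khat) : valuation nu ->
  [pchar k] =i pred0 -> coefficient_ring nu iota nuhat V -> closed_subring nuhat V.
Proof.
move=> nuP char0; have char0K := char0_completion char0; case.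
- move=> U; have tsP := uniformized_term_system completion nuP U.
  rewrite (Vfg_fgring completion tsP).
  exact: fgring_closed_subring vP tsP (@uniformized_dense _ _ _ _ _ _ _ completion nuP U) char0K.
- move=> alpha a0 amon; have tsP := homogeneous_term_system completion nuP amon.
  rewrite (Vfg_fgring completion tsP).
  exact: fgring_closed_subring vP tsP
    (@homogeneous_dense _ _ _ _ _ _ _ completion nuP _ a0 amon) char0K.
- exact: Valg_closed_subring.
exact: Vhat_closed_subring.
Qed.

End CoefficientRings.

(** * The theorem *)

Theorem proposition4p14 (R : realType) (n : nat) (k : fieldType)
    (n_ge2 : (2 <= n)%N) (char0 : [pchar k] =i pred0)
    (nu : {fraction mfps n k} -> \bar R)
    (nu_val : series_valuation nu) (nu_Abhyankar : Abhyankar nu)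
    (Khat : fieldType) (iota : {rmorphism {fraction mfps n k} -> Khat})
    (nuhat : Khat -> \bar R) (nuhat_completion : val_completion nu iota nuhat)
    (Omega : closedFieldType) (emb : {rmorphism Khat -> Omega})
    (nubar : Omega -> \bar R) (nubar_closure : val_closure nuhat emb nubar)
    (V : set Khat) (V_ring : coefficient_ring nu iota nuhat V)
    (d : nat) (P : {poly Khat}) (P_over : poly_over V P)
    (P_monic : P \is monic) (P_deg : size P = d.+1)
    (P_simple : no_multiple_factor V P)
    (r : nat) (Pi : 'I_r -> {poly Khat})
    (Pi_irr : forall i, [/\ poly_over V (Pi i), Pi i \is monic &
                            irreducible_over V (Pi i)])
    (P_factor : P = \prod_(i < r) Pi i)
    (z : 'I_d -> Omega)
    (z_roots : map_poly emb P = \prod_(i < d) ('X - (z i)%:P))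
    (Q : {poly Khat}) (Q_over : poly_over V Q) (Q_monic : Q \is monic)
    (Q_deg : size Q = size P)
    (Q_close : (d%:R%:E *
        \big[Order.max/-oo]_(ij : 'I_d * 'I_d | ij.1 != ij.2)
          nubar (z ij.1 - z ij.2)%R < poly_val nuhat (Q - P)%R)%E) :
  exists Qi : 'I_r -> {poly Khat},
    [/\ forall i, [/\ poly_over V (Qi i), Qi i \is monic &
                      irreducible_over V (Qi i)],
        Q = \prod_(i < r) Qi i &
        forall i, ((d%:R^-1)%:E * poly_val nuhat (Q - P)%R <=
                   poly_val nuhat (Qi i - Pi i)%R)%E].
Proof.
have [nuP _ _] := nu_val; have [emb_alg nubarP nubar_ext] := nubar_closure.
have csr := coefficient_ring_closed_subring nuhat_completion nuP char0 V_ring.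
exact (close_polynomial_factors (completion_val nuhat_completion) nubarP nubar_ext
  (completion_cauchy_cvg nuhat_completion) emb_alg
  (char0_completion (iota := iota) char0) csr P_over P_monic Q_over
  Q_monic P_deg Q_deg Pi_irr P_factor z_roots Q_close).
Qed.
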